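(* Let $u\in H^1(S^1)$ with $u>0$. If $$\int_0^{2\pi}\frac{\cos(\theta+\gamma)}{u^3(\theta)}\,d\theta=0\quad\text{for all }\gamma\in\mathbb{R},$$ then $$\int_0^{2\pi}(u_\theta^2-u^2)\,d\theta\ \int_0^{2\pi}u^{-2}(\theta)\,d\theta\ \ge\ -4\pi^2,$$ and equality holds if and only if $$u(\theta)=c\sqrt{\lambda^2\cos^2(\theta-\alpha)+\lambda^{-2}\sin^2(\theta-\alpha)}$$ for some $\lambda,c>0$ and $\alpha\in[0,2\pi)$.
   Context: $S^1$ is the unit circle, parametrized by the angle $\theta\in[0,2\pi]$; functions on $S^1$ are identified with $2\pi$-periodic functions of $\theta$, and $u_\theta$ denotes the derivative in $\theta$. $H^1(S^1)$ is the usual Sobolev space (its elements are identified with their continuous representatives); $u>0$ means $u$ is positive everywhere. *)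

(* Defs.v *)
From HB Require Import structures.
From mathcomp Require Export all_boot all_order all_algebra.
From mathcomp Require Export all_classical all_reals all_analysis.
Set Implicit Arguments.
Unset Strict Implicit.
Unset Printing Implicit Defensive.
Export Order.TTheory GRing.Theory Num.Theory.
Export numFieldNormedType.Exports.
Local Open Scope classical_set_scope.
Local Open Scope ring_scope.

Notation "\circint_( x ) e" :=
  (\int[lebesgue_measure]_(x in `[0, 2 * pi]%classic) e)%R
  (at level 36, e at level 36, x name, format "\circint_( x )  e") : ring_scope.

(* The C^oo functions on S^1, used as test functions. *)
Definition smooth_circle (R : realType) (phi : R -> R) : Prop :=
  periodic phi (2 * pi) /\ forall (n : nat) (x : R), derivable (derive1n n phi) x 1.

Definition L2_circle (R : realType) (g : R -> R) : Prop :=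
  measurable_fun `[0, 2 * pi]%classic g /\
  lebesgue_measure.-integrable `[0, 2 * pi]%classic
    (fun x => ((g x) ^+ 2)%:E).

(* [g] represents u_theta in L^2(S^1). Only its restriction to [0, 2pi] matters,
   and only up to a null set, so no periodicity is imposed on [g]. *)
Definition weak_derivative (R : realType) (u g : R -> R) : Prop :=
  L2_circle g /\
  forall phi : R -> R, smooth_circle phi ->
    \circint_(x) (u x * derive1 phi x) = - \circint_(x) (g x * phi x).

(* [u] is the continuous representative; continuity and periodicity already
   give u in L^2(S^1). *)
Definition H1_circle (R : realType) (u : R -> R) : Prop :=
  [/\ periodic u (2 * pi), continuous u & exists g : R -> R, weak_derivative u g].

(* Main.v *)
Require Import Defs.
From mathcomp Require Import ring lra.
Set Implicit Arguments.
Unset Strict Implicit.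
Unset Printing Implicit Defensive.
Local Open Scope classical_set_scope.
Local Open Scope ring_scope.

(* Let [rho = u^-3]. The orthogonality condition says that the convex curve [M]
   with radius of curvature [rho] closes up. Let [h] be its support function
   ([h'' + h = rho]), [A] its area and [Om] the integral of [u^-2].

   Minkowski's inequality between [u] and [M]: for a suitable [s > 0] the function
   [u - s h], corrected by a multiple of [cos], vanishes at [0] and [pi], so by
   Wirtinger's inequality on both half circles the quadratic form
   [E (w) = int w'^2 - w^2] is nonnegative at [u - s h], that is
   [E (u) + 2 s Om - 2 s^2 A >= 0].

   Affine isoperimetric inequality [Om^3 <= 8 pi^2 A]: [Om] is the affine length
   of [M]. Parametrize [M] so that its abscissa is [a + b cos t]. For such a
   parametrization the integral of [m' x m''] is exactly [2 A], while [Om] is the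
   integral of [(m' x m'')^(1/3)] over [0, 2 pi], and Hoelder's inequality applies;
   it amounts to integrating a pointwise three-term AM-GM inequality.

   Together, [E (u) Om + 4 pi^2 >= (s Om^2 / (2 pi) - 2 pi)^2]. In the equality
   case the AM-GM inequality is an equality everywhere; this is a separable
   differential equation, whose solutions have [u^2] equal to a quadratic form in
   [(cos, sin)] on each half circle. The closing condition on [M] matches the two
   forms. *)

(** * Derivatives, primitives and absolute continuity *)

(* The library states these rules for operations of the function ring; the
   pointwise forms compose by unification. *)
Lemma der_cst (R : realType) (c x : R) : is_derive x 1 (fun _ : R => c) 0.
Proof. exact: (is_derive_cst c). Qed.

Lemma der_id (R : realType) (x : R) : is_derive x 1 (fun y : R => y) 1.
Proof. exact: is_derive_id. Qed.

Lemma derD (R : realType) (f g : R -> R) (x df dg : R) :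
  is_derive x 1 f df -> is_derive x 1 g dg ->
  is_derive x 1 (fun y => f y + g y) (df + dg).
Proof. by move=> ? ?; exact: is_deriveD. Qed.

Lemma derB (R : realType) (f g : R -> R) (x df dg : R) :
  is_derive x 1 f df -> is_derive x 1 g dg ->
  is_derive x 1 (fun y => f y - g y) (df - dg).
Proof. by move=> ? ?; exact: is_deriveB. Qed.

Lemma derM (R : realType) (f g : R -> R) (x df dg : R) :
  is_derive x 1 f df -> is_derive x 1 g dg ->
  is_derive x 1 (fun y => f y * g y) (df * g x + f x * dg).
Proof.
move=> ? ?; apply: (is_derive_eq (is_deriveM _ _)).
by rewrite /GRing.scale/= addrC [g x * _]mulrC.
Qed.

Lemma derX (R : realType) (f : R -> R) (n : nat) (x df : R) :
  is_derive x 1 f df ->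
  is_derive x 1 (fun y => f y ^+ n) (n%:R * f x ^+ n.-1 * df).
Proof.
move=> ?; have := is_deriveX n; move=> /(_ _ _ f x 1 df) h.
rewrite (_ : (fun y => _) = f ^+ n); first exact: h.
by apply/funext => y; rewrite fctE.
Qed.

Lemma derV (R : realType) (f : R -> R) (x df : R) :
  is_derive x 1 f df -> f x != 0 ->
  is_derive x 1 (fun y => (f y)^-1) (- df / f x ^+ 2).
Proof.
move=> ? fx0; apply: (is_derive_eq (is_deriveV fx0 _)).
by rewrite /GRing.scale/= !mulNr mulrC.
Qed.

Lemma der_comp (R : realType) (h f : R -> R) (x dh df : R) :
  is_derive x 1 f df -> is_derive (f x) 1 h dh ->
  is_derive x 1 (fun y => h (f y)) (dh * df).
Proof. by move=> df_ dh_; exact: (is_derive1_comp dh_ df_). Qed.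

Lemma der_sqrt (R : realType) (f : R -> R) (x df : R) :
  is_derive x 1 f df -> 0 < f x ->
  is_derive x 1 (fun y => Num.sqrt (f y)) (df / (2 * Num.sqrt (f x))).
Proof.
move=> dfx fx0; rewrite mulrC; exact: (der_comp dfx (is_derive1_sqrt fx0)).
Qed.

Lemma cts_cst (R : realType) (A : set R) (c : R) : {within A, continuous (fun _ : R => c)}.
Proof. by apply: continuous_subspaceT => t; exact: cvg_cst. Qed.

Lemma ctsD (R : realType) (A : set R) (f g : R -> R) :
  {within A, continuous f} -> {within A, continuous g} ->
  {within A, continuous (fun x => f x + g x)}.
Proof. exact: within_continuousD. Qed.

Lemma ctsM (R : realType) (A : set R) (f g : R -> R) :
  {within A, continuous f} -> {within A, continuous g} ->
  {within A, continuous (fun x => f x * g x)}.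
Proof. by move=> cf cg x; apply: cvgM; [exact: cf|exact: cg]. Qed.

Lemma ctsN (R : realType) (A : set R) (f : R -> R) :
  {within A, continuous f} -> {within A, continuous (fun x => - f x)}.
Proof. by move=> cf x; apply: cvgN; exact: cf. Qed.

Lemma ctsB (R : realType) (A : set R) (f g : R -> R) :
  {within A, continuous f} -> {within A, continuous g} ->
  {within A, continuous (fun x => f x - g x)}.
Proof. by move=> cf cg; apply: ctsD => //; exact: ctsN. Qed.

Lemma ctsX (R : realType) (A : set R) (f : R -> R) n :
  {within A, continuous f} -> {within A, continuous (fun x => f x ^+ n)}.
Proof.
move=> cf; elim: n => [|n IH]; first exact: cts_cst.
by under eq_fun do rewrite exprS; exact: ctsM.
Qed.

Lemma ctsV (R : realType) (A : set R) (f : R -> R) : (forall x, f x != 0) ->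
  {within A, continuous f} -> {within A, continuous (fun x => (f x)^-1)}.
Proof. by move=> f0 cf x; apply: cvgV; [exact: f0|exact: cf]. Qed.

Lemma continuous_shift (R : realType) (f : R -> R) (c : R) :
  continuous f -> continuous (fun x => f (x + c)).
Proof.
move=> cf x; apply: (@continuous_comp _ _ _ (fun x => x + c) f); last exact: cf.
by apply: cvgD; [exact: cvg_id|exact: cvg_cst].
Qed.

Lemma cts_sin (R : realType) (A : set R) : {within A, continuous (@sin R)}.
Proof. by apply: continuous_subspaceT; exact: continuous_sin. Qed.

Lemma cts_cos (R : realType) (A : set R) : {within A, continuous (@cos R)}.
Proof. by apply: continuous_subspaceT; exact: continuous_cos. Qed.

(** * Lebesgue integrals over a segment *)

Definition intable (R : realType) (a b : R) (f : R -> R) : Prop :=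
  lebesgue_measure.-integrable `[a, b]%classic (EFin \o f).

Definition integ (R : realType) (a b : R) (f : R -> R) : R :=
  \int[lebesgue_measure]_(x in `[a, b]%classic) f x.

Lemma intableS (R : realType) (a b c d : R) (f : R -> R) :
  a <= c -> d <= b -> intable a b f -> intable c d f.
Proof.
move=> ac db; apply: integrableS; [exact: measurable_itv..|].
by apply: subset_itvScc; rewrite !bnd_simp.
Qed.

Lemma continuous_intable (R : realType) (a b : R) (f : R -> R) :
  {within `[a, b], continuous f} -> intable a b f.
Proof. by move=> cf; apply: continuous_compact_integrable => //; exact: segment_compact. Qed.

Lemma intableM (R : realType) (a b : R) (f h : R -> R) :
  intable a b f -> {within `[a, b], continuous h} ->
  intable a b (fun x => f x * h x).
Proof.
move=> intf ch.
have := @integrableMl _ _ R lebesgue_measure `[a, b]%classic (measurable_itv _) _ h intf.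
apply.
  by apply: measurable_realfun.subspace_continuous_measurable_fun => //; exact: measurable_itv.
have /compact_bounded[M [_ mrt]] := continuous_compact ch (@segment_compact R a b).
by exists M; split; rewrite ?num_real // => ? ? ? ?; exact: mrt.
Qed.

Lemma intableD (R : realType) (a b : R) (f g : R -> R) :
  intable a b f -> intable a b g -> intable a b (fun x => f x + g x).
Proof.
move=> intf intg; have := @integrableD _ _ R lebesgue_measure _ (measurable_itv _) _ _ intf intg.
by apply: eq_integrable => // x _ /=; rewrite EFinD.
Qed.

Lemma intableZ (R : realType) (a b k : R) (f : R -> R) :
  intable a b f -> intable a b (fun x => k * f x).
Proof.
move=> intf; have := @integrableZl _ _ R lebesgue_measure _ (measurable_itv _) k _ intf.
by apply: eq_integrable => // x _ /=; rewrite EFinM.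
Qed.

Lemma intable_norm (R : realType) (a b : R) (f : R -> R) :
  intable a b f -> intable a b (fun x => `|f x|).
Proof. exact: integrable_norm. Qed.

Lemma eq_integ (R : realType) (a b : R) (f g : R -> R) :
  (forall x, a <= x <= b -> f x = g x) -> integ a b f = integ a b g.
Proof. by move=> fg; apply: eq_Rintegral => x; rewrite inE/= in_itv/=; exact: fg. Qed.

Lemma integD (R : realType) (a b : R) (f g : R -> R) :
  intable a b f -> intable a b g ->
  integ a b (fun x => f x + g x) = integ a b f + integ a b g.
Proof. by move=> intf intg; apply: RintegralD; [exact: measurable_itv|..]. Qed.

Lemma integZ (R : realType) (a b k : R) (f : R -> R) :
  intable a b f -> integ a b (fun x => k * f x) = k * integ a b f.
Proof. by move=> intf; apply: RintegralZl; [exact: measurable_itv|..]. Qed.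

Lemma integxx (R : realType) (a : R) (f : R -> R) : integ a a f = 0.
Proof. by rewrite /integ set_itv1 Rintegral_set1. Qed.

Lemma integ_cat (R : realType) (a b c : R) (f : R -> R) :
  a <= b <= c -> intable a c f -> integ a c f = integ a b f + integ b c f.
Proof.
move=> /andP[ab bc] intf.
have h := @Rintegral_itvB R f (BLeft a) (BRight c) b intf.
have := h; rewrite !bnd_simp => /(_ ab bc) => {}h.
apply/eqP; rewrite addrC -subr_eq; apply/eqP; rewrite /integ h.
rewrite Rintegral_itv_obnd_cbnd//.
apply: integrableS intf; [exact: measurable_itv..|].
by apply: subset_itv; rewrite bnd_simp.
Qed.

Lemma le_integ (R : realType) (a b : R) (f g : R -> R) :
  intable a b f -> intable a b g -> (forall x, a <= x <= b -> f x <= g x) ->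
  integ a b f <= integ a b g.
Proof. by move=> intf intg fg; apply: le_Rintegral. Qed.

Lemma integ_ge0 (R : realType) (a b : R) (f : R -> R) :
  (forall x, a <= x <= b -> 0 <= f x) -> 0 <= integ a b f.
Proof. by move=> fg; apply: Rintegral_ge0. Qed.

Lemma le_norm_integ (R : realType) (a b : R) (f : R -> R) :
  intable a b f -> `|integ a b f| <= integ a b (fun x => `|f x|).
Proof. by move=> intf; apply: le_normr_Rintegral. Qed.

(* Absolute continuity on [a, b], [f] being the almost everywhere derivative of [F]. *)
Definition primitive (R : realType) (a b : R) (F f : R -> R) : Prop :=
  intable a b f /\ forall x, a <= x <= b -> F x = F a + integ a x f.

Lemma primitiveE (R : realType) (a b : R) (F f : R -> R) : a <= b ->
  primitive a b F f -> F b - F a = integ a b f.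
Proof. by move=> ab [_ /(_ b)]; rewrite ab lexx => ->//; rewrite addrC addKr. Qed.

Lemma primitiveS (R : realType) (a b c d : R) (F f : R -> R) :
  a <= c -> c <= d -> d <= b -> primitive a b F f -> primitive c d F f.
Proof.
move=> ac cd db [intf FE]; split; first exact: intableS intf.
move=> x /andP[cx xd]; rewrite (FE x); last by rewrite (le_trans ac cx) (le_trans xd db).
rewrite (FE c); last by rewrite ac (le_trans cd db).
rewrite -addrA (@integ_cat _ a c x) ?ac ?cx//.
by apply: intableS intf => //; exact: le_trans db.
Qed.

Lemma primitive_continuous (R : realType) (a b : R) (F f : R -> R) : a <= b ->
  primitive a b F f -> {within `[a, b], continuous F}.
Proof.
move=> ab [intf FE].
have h : {within `[a, b], continuous (cst (F a) + (fun x => integ a x f))}.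
  apply: within_continuousD; last exact: parameterized_integral_continuous.
  by apply: continuous_subspaceT => x; exact: cvg_cst.
apply: (subspace_eq_continuous _ h) => x; rewrite inE/= in_itv/= => xab.
exact: esym (FE x xab).
Qed.

(** Continuity up to the end points replaces differentiability there: in the equality case the
    formula for the derivative is known only in the interior. *)
Lemma derivable_primitive (R : realType) (a b : R) (F f : R -> R) :
  {within `[a, b], continuous F} -> {within `[a, b], continuous f} ->
  (forall x, a < x < b -> is_derive x 1 F (f x)) ->
  primitive a b F f.
Proof.
move=> cF cf dF; split; first exact: continuous_intable.
move=> x /andP[]; rewrite le_eqVlt => /predU1P[<- _|ax xb].
  by rewrite integxx addr0.
have sub : `[a, x] `<=` `[a, b] by apply: subset_itvl; rewrite bnd_simp.
have cF' := continuous_subspaceW sub cF.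
rewrite /integ /Rintegral (@continuous_FTC2 _ f F a x)//; first by rewrite /=; ring.
- exact: continuous_subspaceW cf.
- have [/= h1 h2 h3] := (continuous_within_itvP F ax).1 cF'.
  split => // y; rewrite in_itv/= => /andP[ay yx].
  by have [] := dF y; rewrite ?ay ?(lt_le_trans yx xb).
- move=> y; rewrite in_itv/= => /andP[ay yx]; rewrite derive1E.
  by have [] := dF y; rewrite ?ay ?(lt_le_trans yx xb).
Qed.

Lemma primitiveD (R : realType) (a b : R) (F f G g : R -> R) :
  primitive a b F f -> primitive a b G g ->
  primitive a b (fun x => F x + G x) (fun x => f x + g x).
Proof.
move=> [intf FE] [intg GE]; split; first exact: intableD.
move=> x xab; have [ax xb] := andP xab; rewrite (FE x)// (GE x)// integD; first ring.
  exact: intableS intf.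
exact: intableS intg.
Qed.

Lemma primitiveZ (R : realType) (a b k : R) (F f : R -> R) :
  primitive a b F f -> primitive a b (fun x => k * F x) (fun x => k * f x).
Proof.
move=> [intf FE]; split; first exact: intableZ.
move=> x xab; have [ax xb] := andP xab; rewrite (FE x)// integZ; first ring.
exact: intableS intf.
Qed.

Lemma eq_primitive (R : realType) (a b : R) (F f G g : R -> R) :
  (forall x, F x = G x) -> (forall x, f x = g x) ->
  primitive a b F f -> primitive a b G g.
Proof. by move=> /funext -> /funext ->. Qed.

Lemma primitive_le (R : realType) (a b : R) (M m : R -> R) x y :
  primitive a b M m -> (forall x, 0 <= m x) ->
  a <= x -> x <= y -> y <= b -> M x <= M y.
Proof.
move=> PM m0 ax xy yb; rewrite -subr_ge0 (primitiveE xy (primitiveS ax xy yb PM)).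
exact: integ_ge0.
Qed.

(* Halving the increment of [M] divides the bound by two: the intermediate
   value theorem turns a quadratic modulus into constancy. *)
Lemma quadratic_modulus_cst (R : realType) (a b : R) (M D : R -> R) :
  a <= b -> {within `[a, b], continuous M} ->
  (forall x y, a <= x -> x <= y -> y <= b -> M x <= M y) ->
  (forall x y, a <= x -> x <= y -> y <= b -> `|D y - D x| <= (M y - M x) ^+ 2) ->
  D b = D a.
Proof.
move=> ab cM Mmono DM.
have H n : forall x y, a <= x -> x <= y -> y <= b ->
    `|D y - D x| <= (M y - M x) ^+ 2 / 2 ^+ n.
  elim: n => [|n IH] x y ax xy yb; first by rewrite expr0 divr1; exact: DM.
  have cM' : {within `[x, y], continuous M}.
    by apply: continuous_subspaceW cM; apply: subset_itvScc; rewrite !bnd_simp.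
  have Mxy := Mmono _ _ ax xy yb.
  have [|c] := IVT (v := (M x + M y) / 2) xy cM'.
    by rewrite min_l// max_r//; apply/andP; split; lra.
  rewrite in_itv/= => /andP[xc cy] Mc.
  have h1 := IH x c ax xc (le_trans cy yb).
  have h2 := IH c y (le_trans ax xc) cy yb.
  have -> : D y - D x = (D y - D c) + (D c - D x) by ring.
  apply: (le_trans (ler_normD _ _)); apply: (le_trans (lerD h2 h1)).
  rewrite Mc (exprS 2 n) le_eqVlt; apply/orP; left; apply/eqP; field.
  by rewrite expf_neq0//; lra.
apply/eqP; rewrite -subr_eq0 -normr_eq0; apply/negP => /negP nz.
have D0 : 0 < `|D b - D a| by rewrite lt_neqAle eq_sym nz normr_ge0.
set K := (M b - M a) ^+ 2.
have [n nP] : exists n : nat, K / `|D b - D a| < n%:R.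
  by exists (Num.bound (K / `|D b - D a|)); rewrite archi_boundP// divr_ge0 ?sqr_ge0.
have := H n a b (lexx a) ab (lexx b); rewrite -/K leNgt => /negP; apply.
rewrite ltr_pdivrMr ?exprn_gt0// mulrC -ltr_pdivrMr//.
apply: (lt_trans nP); rewrite -natrX ltr_nat.
exact: ltn_expl.
Qed.

(* The defect of the product rule over [x, y] is at most the square of the
   integral of [|f| + |g|] over [x, y]. *)
Lemma primitiveM_ends (R : realType) (a b : R) (F f G g : R -> R) : a <= b ->
  primitive a b F f -> primitive a b G g ->
  F b * G b = F a * G a + integ a b (fun x => f x * G x + g x * F x).
Proof.
move=> ab PF PG; have [intf FE] := PF; have [intg GE] := PG.
pose m x := `|f x| + `|g x|.
have intm : intable a b m by apply: intableD; exact: intable_norm.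
pose M x := integ a x m.
have PM : primitive a b M m by split => // x xab; rewrite /M integxx add0r.
have m0 x : 0 <= m x by rewrite addr_ge0.
have cF := primitive_continuous ab PF; have cG := primitive_continuous ab PG.
pose k x := f x * G x + g x * F x.
have intk : intable a b k by apply: intableD; exact: intableM.
pose D x := F x * G x - integ a x k.
suff : D b = D a by rewrite /D integxx => /eqP; rewrite subr_eq subr0 => /eqP ->.
apply: (@quadratic_modulus_cst _ a b M) => //.
- exact: primitive_continuous PM.
- by move=> x y ax xy yb; apply: primitive_le PM m0 ax xy yb.
move=> x y ax xy yb.
have PFxy := primitiveS ax xy yb PF; have PGxy := primitiveS ax xy yb PG.
have PMxy := primitiveS ax xy yb PM.
have cFxy := primitive_continuous xy PFxy; have cGxy := primitive_continuous xy PGxy.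
have intkxy : intable x y k by exact: intableS intk.
have [intfxy _] := PFxy; have [intgxy _] := PGxy.
(* Since [F y * G y - F x * G x = (F y - F x) * G x + F y * (G y - G x)], the defect over [x, y] is
   the integral of [r]. There [f] and [g] are multiplied by oscillations of [G] and [F], which are
   at most [M y - M x]. *)
pose r t := f t * (G x - G t) + g t * (F y - F t).
have cr1 : {within `[x, y], continuous (fun t => G x - G t)}.
  by apply: (@within_continuousB _ _ _ _ (cst (G x)) G) => //;
     apply: continuous_subspaceT => t; exact: cvg_cst.
have cr2 : {within `[x, y], continuous (fun t => F y - F t)}.
  by apply: (@within_continuousB _ _ _ _ (cst (F y)) F) => //;
     apply: continuous_subspaceT => t; exact: cvg_cst.
have intr : intable x y r by apply: intableD; exact: intableM.
have DE : D y - D x = integ x y r.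
  rewrite /D (@integ_cat _ a x y) ?ax ?xy//; last exact: intableS intk.
  have -> : integ x y r = integ x y (fun t => G x * f t + F y * g t + (-1) * k t).
    by apply: eq_integ => t _; rewrite /r /k; ring.
  have iA := intableZ (G x) intfxy; have iB := intableZ (F y) intgxy.
  have iC := intableZ (-1) intkxy; have iAB := intableD iA iB.
  rewrite (integD iAB iC) (integD iA iB) !integZ//.
  rewrite -(primitiveE xy PFxy) -(primitiveE xy PGxy); ring.
have osc (H h : R -> R) s t : primitive a b H h -> (forall z, `|h z| <= m z) ->
    x <= s -> s <= t -> t <= y -> `|H t - H s| <= M y - M x.
  move=> PH hm xs st ty.
  have as_ := le_trans ax xs; have tb := le_trans ty yb.
  have PHst := primitiveS as_ st tb PH; have [inth _] := PHst.
  rewrite (primitiveE st PHst); apply: (le_trans (le_norm_integ inth)).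
  apply: (@le_trans _ _ (integ s t m)).
    apply: le_integ => //; [exact: intable_norm|exact: intableS intm].
  rewrite -(primitiveE st (primitiveS as_ st tb PM)).
  apply: lerB; first exact: (primitive_le PM m0 (le_trans as_ st) ty yb).
  exact: (primitive_le PM m0 ax xs (le_trans st tb)).
rewrite DE; apply: (le_trans (le_norm_integ intr)).
apply: (@le_trans _ _ (integ x y (fun t => (M y - M x) * m t))); last first.
  rewrite integZ; last exact: intableS intm.
  by rewrite -(primitiveE xy PMxy) expr2.
apply: le_integ.
- exact: intable_norm.
- by apply: intableZ; exact: intableS intm.
move=> t /andP[xt ty]; rewrite /r /m [(M y - M x) * _]mulrDr.
apply: (le_trans (ler_normD _ _)); rewrite !normrM.
rewrite [`|f t| * _]mulrC [`|g t| * _]mulrC.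
apply: lerD.
  apply: ler_wpM2r => //; rewrite distrC.
  by apply: (osc G g) => // z; rewrite /m lerDr.
apply: ler_wpM2r => //.
by apply: (osc F f) => // z; rewrite /m lerDl.
Qed.

Lemma primitiveM (R : realType) (a b : R) (F f G g : R -> R) : a <= b ->
  primitive a b F f -> primitive a b G g ->
  primitive a b (fun x => F x * G x) (fun x => f x * G x + g x * F x).
Proof.
move=> ab PF PG; have [intf _] := PF; have [intg _] := PG.
have cF := primitive_continuous ab PF; have cG := primitive_continuous ab PG.
split; first by apply: intableD; exact: intableM.
move=> x /andP[ax xb]; apply: primitiveM_ends => //.
  exact: primitiveS PF.
exact: primitiveS PG.
Qed.

Lemma derivable_primitiveT (R : realType) (a b : R) (F f : R -> R) :
  (forall x, a <= x <= b -> is_derive x 1 F (f x)) ->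
  {within `[a, b], continuous f} ->
  primitive a b F f.
Proof.
move=> dF cf; apply: derivable_primitive => // [|x /andP[ax xb]].
  by apply: derivable_within_continuous => x; rewrite in_itv/= => /dF[].
by apply: dF; rewrite !ltW.
Qed.

(** * Wirtinger's inequality *)

(* The weight [k tan (k (x - m))] of the completed square is bounded on the
   closed interval only for [k < 1]; [wirtinger] lets [k] tend to [1]. *)
Lemma wirtinger_lt1 (R : realType) (a k : R) (w w' : R -> R) :
  0 < k < 1 ->
  primitive a (a + pi) w w' -> intable a (a + pi) (fun x => w' x ^+ 2) ->
  w a = 0 -> w (a + pi) = 0 ->
  k ^+ 2 * integ a (a + pi) (fun x => w x ^+ 2) <=
  integ a (a + pi) (fun x => w' x ^+ 2).
Proof.
move=> /andP[k0 k1] Pw iw'2 wa wb; set b := a + pi.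
have pi0 := @pi_gt0 R.
have ab : a <= b by rewrite lerDl pi_ge0.
pose m := a + pi / 2.
pose T x := k * tan (k * (x - m)).
pose T' x := k ^+ 2 + T x ^+ 2.
have cosn0 x : a <= x <= b -> cos (k * (x - m)) != 0.
  move=> /andP[ax xb]; rewrite gt_eqF//; apply: cos_gt0_pihalf.
  have := ltr_pM2r pi0 k 1; rewrite k1 mul1r => kpi.
  have h1 : 0 <= k * (x - a) by rewrite mulr_ge0 ?subr_ge0// ltW.
  have h2 : 0 <= k * (b - x) by rewrite mulr_ge0 ?subr_ge0// ltW.
  by rewrite /m; rewrite /b in h2; apply/andP; split; nra.
have dT x : a <= x <= b -> is_derive x 1 T (T' x).
  move=> xab; apply: (is_derive_eq (derM (der_cst k x) (der_comp
    (derM (der_cst k x) (derB (der_id x) (der_cst m x))) (is_derive_tan (cosn0 _ xab))))).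
  by rewrite (cos2_tan2 (cosn0 _ xab)) /T' /T; ring.
have cT : {within `[a, b], continuous T}.
  by apply: derivable_within_continuous => x; rewrite in_itv/= => /dT[].
have cT' : {within `[a, b], continuous T'}.
  by apply: ctsD; [exact: cts_cst|exact: ctsX].
have PT := derivable_primitiveT dT cT'.
(* As [w] vanishes at both ends, the derivative of [w ^+ 2 * T] has integral zero. Added to
   [w' ^+ 2], it gives [k ^+ 2 * w ^+ 2] plus the square of [w' + T * w]. *)
have Pw2 := primitiveM ab Pw Pw; have Pw2T := primitiveM ab Pw2 PT.
have := primitiveE ab Pw2T; rewrite wa wb !mul0r subr0 => E0.
have cw := primitive_continuous ab Pw.
have iw2 : intable a b (fun x => w x ^+ 2).
  by apply: continuous_intable => x; apply: cvgM; exact: cw.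
have [iT _] := Pw2T.
rewrite -integZ// -[leRHS]addr0 [X in _ + X]E0 -integD//.
apply: le_integ; [exact: intableZ|exact: intableD|].
move=> x _; rewrite /T' -subr_ge0.
rewrite (_ : _ - _ = (w' x + T x * w x) ^+ 2) ?sqr_ge0//; ring.
Qed.

Lemma wirtinger (R : realType) (a : R) (w w' : R -> R) :
  primitive a (a + pi) w w' -> intable a (a + pi) (fun x => w' x ^+ 2) ->
  w a = 0 -> w (a + pi) = 0 ->
  integ a (a + pi) (fun x => w x ^+ 2) <= integ a (a + pi) (fun x => w' x ^+ 2).
Proof.
move=> Pw iw'2 wa wb; set W := (leLHS); set K := (leRHS).
have K0 : 0 <= K by apply: integ_ge0 => x _; exact: sqr_ge0.
rewrite leNgt; apply/negP => KW; have W0 := le_lt_trans K0 KW.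
(* For [k = (1 + t) / 2] one has [k ^+ 2 - t = ((1 - t) / 2) ^+ 2 > 0], so [k ^+ 2 * W > K], against
   [wirtinger_lt1]. *)
pose t := K / W.
have t0 : 0 <= t by rewrite divr_ge0// ltW.
have t1 : t < 1 by rewrite ltr_pdivrMr// mul1r.
have k01 : 0 < (1 + t) / 2 < 1 by apply/andP; split; lra.
have := wirtinger_lt1 k01 Pw iw'2 wa wb; rewrite -/W -/K leNgt => /negP; apply.
rewrite -ltr_pdivrMr// -/t; nra.
Qed.

Lemma primitive_is_derive (R : realType) (a b x : R) (F f : R -> R) :
  primitive a b F f -> {within `[a, b], continuous f} -> a < x < b ->
  is_derive x 1 F (f x).
Proof.
move=> [intf FE] cf /andP[ax xb].
have fx : {for x, continuous f}.
  by apply: (within_continuous_continuous (lt_trans ax xb) cf); rewrite in_itv/= ax.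
have [dI I'] := continuous_FTC1_closed xb intf ax fx.
have hI : is_derive x 1 (fun y => integ a y f) (f x).
  by apply: DeriveDef; [exact: dI|rewrite -derive1E; exact: I'].
apply: (near_eq_is_derive _ (is_derive_eq (derD (der_cst (F a) x) hI) _)); last by rewrite add0r.
near=> y; rewrite (FE y)//; apply/andP; split.
  by apply/ltW; near: y; exact: lt_nbhsr.
by apply/ltW; near: y; exact: lt_nbhsl.
Unshelve. all: by end_near. Qed.

(** * The affine isoperimetric inequality *)

(** AM-GM for [r ^+ 2 / k ^+ 2] and two copies of [k * (v ^+ 3 / r)], whose product is [v ^+ 6]. The
    defect is the square of [r - k * v] times a positive factor. *)
Lemma am_gm3_defect (R : realType) (k r v : R) : 0 < k -> 0 < r -> 0 < v ->
  0 <= r ^+ 2 / k ^+ 2 + 2 * k * (v ^+ 3 / r) - 3 * v ^+ 2 /\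
  (r ^+ 2 / k ^+ 2 + 2 * k * (v ^+ 3 / r) - 3 * v ^+ 2 = 0 -> r = k * v).
Proof.
move=> k0 r0 v0.
have -> : r ^+ 2 / k ^+ 2 + 2 * k * (v ^+ 3 / r) - 3 * v ^+ 2 =
    (r - k * v) ^+ 2 * ((r + 2 * (k * v)) / (k ^+ 2 * r)).
  by field; rewrite !gt_eqF.
have p0 : 0 < (r + 2 * (k * v)) / (k ^+ 2 * r).
  by rewrite divr_gt0 ?addr_gt0 ?mulr_gt0 ?exprn_gt0.
split; first by rewrite mulr_ge0 ?sqr_ge0// ltW.
move/eqP; rewrite mulf_eq0 (gt_eqF p0) orbF sqrf_eq0 subr_eq0.
by move/eqP.
Qed.

(** These are the boundary terms of an integration by parts against the cotangent. The derivative
    [2 * xi * sin * rho] of [b ^+ 2 - xi ^+ 2] vanishes at both ends while that of [sin] tends to 1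
    or -1, so l'Hopital's rule gives 0. *)
Lemma half_circle_cot_lim (R : realType) (b : R) (xi rho : R -> R) :
  {within `[0, pi], continuous rho} ->
  xi 0 = b -> xi pi = - b ->
  primitive 0 pi xi (fun x => - (sin x * rho x)) ->
  ((b ^+ 2 - xi x ^+ 2) / sin x * cos x @[x --> 0^'+] --> 0) /\
  ((b ^+ 2 - xi x ^+ 2) / sin x * cos x @[x --> pi^'-] --> 0).
Proof.
move=> crho xi0 xipi Pxi; have pi0 := @pi_gt0 R.
have cxi := primitive_continuous (ltW pi0) Pxi.
have cxi' : {within `[0, pi], continuous (fun x => - (sin x * rho x))}.
  by apply: ctsN; apply: ctsM => //; exact: cts_sin.
pose f x := b ^+ 2 - xi x ^+ 2.
pose df x := 2 * xi x * (sin x * rho x).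
have cf : {within `[0, pi], continuous f}.
  by apply: ctsB; [exact: cts_cst|exact: ctsX].
have cdf : {within `[0, pi], continuous df}.
  by repeat apply: ctsM => //; [exact: cts_cst|exact: cts_sin].
have [_ f0 fpi] := (continuous_within_itvP f pi0).1 cf.
have [_ df0 dfpi] := (continuous_within_itvP df pi0).1 cdf.
rewrite /f xi0 subrr in f0; rewrite /f xipi sqrrN subrr in fpi.
rewrite /df sin0 mul0r mulr0 in df0; rewrite /df sinpi mul0r mulr0 in dfpi.
have dfE x : 0 < x < pi -> is_derive x 1 f (df x).
  move=> xpi; apply: (is_derive_eq (derB (der_cst _ x) (derX 2 (primitive_is_derive Pxi cxi' xpi)))).
  by rewrite /df /= expr1; ring.
have cos0r : cos x @[x --> (0 : R)^'+] --> (1 : R).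
  by rewrite -[X in _ --> X](@cos0 R); apply: cvg_at_right_filter; exact: continuous_cos.
have cospil : cos x @[x --> (pi : R)^'-] --> (-1 : R).
  by rewrite -(@cospi R); apply: cvg_at_left_filter; exact: continuous_cos.
split.
- rewrite -[X in _ --> X](mul0r (1 : R)); apply: cvgM => //.
  apply: (@lhopital_at_right _ f df sin cos 0 (pi / 2)).
  + by rewrite divr_gt0.
  + by move=> x; rewrite in_itv/= => /andP[x0 x1]; apply: dfE; rewrite x0/=; lra.
  + exact: f0.
  + by rewrite -[X in _ --> X](@sin0 R); apply: cvg_at_right_filter; exact: continuous_sin.
  + move=> x; rewrite in_itv/= => /andP[x0 x1].
    by rewrite gt_eqF// cos_gt0_pihalf// x1 andbT; lra.
  + by rewrite -[X in _ --> X](mul0r (1^-1 : R)); apply: cvgM; [exact: df0|exact: cvgV].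
- rewrite -[X in _ --> X](mul0r (-1 : R)); apply: cvgM => //.
  apply: (@lhopital_at_left _ f df sin cos (pi / 2) pi).
  + lra.
  + by move=> x; rewrite in_itv/= => /andP[x0 x1]; apply: dfE; rewrite x1 andbT; lra.
  + exact: fpi.
  + by rewrite -(@sinpi R); apply: cvg_at_left_filter; exact: continuous_sin.
  + move=> x; rewrite in_itv/= => /andP[x0 x1]; rewrite -(subrK pi x) cosDpi oppr_eq0.
    by rewrite gt_eqF// cos_gt0_pihalf//; apply/andP; split; lra.
  + rewrite -[X in _ --> X](mul0r ((-1)^-1 : R)); apply: cvgM; first exact: dfpi.
    by apply: cvgV => //; rewrite oppr_eq0 oner_eq0.
Qed.

(** The derivative of [xi] is negative inside, so [xi] decreases strictly from [b] to [- b]. This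
    makes [acos (xi / b)] differentiable there. *)
Lemma half_circle_bounds (R : realType) (b : R) (xi rho : R -> R) :
  {within `[0, pi], continuous rho} -> (forall x, 0 < rho x) ->
  xi 0 = b -> xi pi = - b ->
  primitive 0 pi xi (fun x => - (sin x * rho x)) ->
  forall x, 0 < x < pi -> - b < xi x < b.
Proof.
move=> crho rho0 xi0 xipi Pxi; have pi0 := @pi_gt0 R.
have cxi := primitive_continuous (ltW pi0) Pxi.
have cxi' : {within `[0, pi], continuous (fun x => - (sin x * rho x))}.
  by apply: ctsN; apply: ctsM => //; exact: cts_sin.
have dxi x : 0 < x < pi -> is_derive x 1 xi (- (sin x * rho x)).
  by move=> xpi; exact: (primitive_is_derive Pxi cxi' xpi).
have mono := @ltr0_derive1_lt_cc R xi 0 pi _ _ cxi.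
move=> x /andP[x0 xpi]; rewrite -{1}xipi -xi0; apply/andP; split; apply: mono;
  rewrite ?in_itv/= ?lexx ?ltW// => y; rewrite in_itv/= => yb.
- by have [] := dxi _ yb.
- rewrite derive1E; have [_ ->] := dxi _ yb.
  by rewrite oppr_lt0 mulr_gt0// sin_gt0_pi.
- by have [] := dxi _ yb.
- rewrite derive1E; have [_ ->] := dxi _ yb.
  by rewrite oppr_lt0 mulr_gt0// sin_gt0_pi.
Qed.

(** Moving [x] towards [a] and [y] towards [b] only enlarges the increment of [G], which is then
    compared with the limits of [B]. In the application [G - B] is a multiple of an [acos], bounded
    by [K], and its limits at the ends need not be computed. *)
Lemma nondecreasing_increment_le (R : realType) (a b : R) (B G : R -> R) (la lb K : R) :
  a < b ->
  B x @[x --> a^'+] --> la -> B x @[x --> b^'-] --> lb ->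
  (forall x, a < x < b -> B x <= G x <= B x + K) ->
  (forall x y, a < x -> x <= y -> y < b -> G x <= G y) ->
  forall x y, a < x -> x <= y -> y < b -> G y - G x <= lb - la + K.
Proof.
move=> ab Ba Bb BG Gmono x y ax xy yb.
have step x' : a < x' -> x' < x -> G y - G x <= lb - B x' + K.
  move=> ax' x'x; rewrite -lerBlDr -lerBlDr opprK; apply: (cvgr_to_ge Bb).
  near=> y'.
  have yy' : y <= y' by apply/ltW; near: y'; exact: nbhs_left_gt.
  have y'b : y' < b by near: y'; exact: nbhs_left_lt.
  have /andP[_ h1] : B y' <= G y' <= B y' + K.
    by apply: BG; rewrite y'b (lt_le_trans ax)//; exact: (le_trans xy yy').
  have x'b : x' < b by exact: (lt_trans x'x (le_lt_trans xy yb)).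
  have /andP[h2 _] : B x' <= G x' <= B x' + K by apply: BG; rewrite ax' x'b.
  have h3 : G x' <= G x by apply: Gmono => //; [exact: ltW|exact: (le_lt_trans xy yb)].
  have h4 : G y <= G y' by apply: Gmono => //; exact: (lt_le_trans ax xy).
  lra.
have : - (lb + K - (G y - G x)) <= - la.
  apply: (cvgr_to_ge (cvgN Ba)); near=> x'.
  have ax' : a < x' by near: x'; exact: nbhs_right_gt.
  have x'x : x' < x by near: x'; exact: nbhs_right_lt.
  by have := step _ ax' x'x; rewrite lerN2; lra.
lra.
Unshelve. all: by end_near. Qed.

(* The affine isoperimetric inequality for one half of a convex curve with
   curvature radius [u^-3]: the curve is parametrized by the angle
   [t = acos (xi / b)], which increases from [0] to [pi]. *)
Lemma half_circle_ineq (R : realType) (b k : R) (u xi : R -> R) :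
  0 < b -> 0 < k -> continuous u -> (forall x, 0 < u x) ->
  xi 0 = b -> xi pi = - b ->
  primitive 0 pi xi (fun x => - (sin x * u x ^- 3)) ->
  3 * integ 0 pi (fun x => u x ^- 2) <=
    2 / k ^+ 2 * integ 0 pi (fun x => xi x * (cos x * u x ^- 3)) + 2 * k * pi /\
  (3 * integ 0 pi (fun x => u x ^- 2) =
    2 / k ^+ 2 * integ 0 pi (fun x => xi x * (cos x * u x ^- 3)) + 2 * k * pi ->
   forall x, 0 < x < pi ->
    (b ^+ 2 - xi x ^+ 2) * u x ^+ 2 = k ^+ 2 * sin x ^+ 2).
Proof.
move=> b0 k0 cu u0 xi0 xipi Pxi; have pi0 := @pi_gt0 R.
have un0 x : u x != 0 by rewrite gt_eqF.
have rho0 x : 0 < u x ^- 3 by rewrite invr_gt0 exprn_gt0.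
have cuw : {within `[0, pi], continuous u} by exact: continuous_subspaceT.
have cun n : {within `[0, pi], continuous (fun x => u x ^- n)}.
  by apply: ctsV; [move=> x; rewrite expf_neq0|exact: ctsX].
have cxi := primitive_continuous (ltW pi0) Pxi.
have crho := cun 3.
have cxi' : {within `[0, pi], continuous (fun x => - (sin x * u x ^- 3))}.
  by apply: ctsN; apply: ctsM => //; exact: cts_sin.
have dxi x : 0 < x < pi -> is_derive x 1 xi (- (sin x * u x ^- 3)).
  by move=> xpi; exact: (primitive_is_derive Pxi cxi' xpi).
have xib := half_circle_bounds crho rho0 xi0 xipi Pxi.
have [lim0 limpi] := half_circle_cot_lim crho xi0 xipi Pxi.
pose j x := 2 / k ^+ 2 * (xi x * (cos x * u x ^- 3)) + (-3) * u x ^- 2.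
have cxc : {within `[0, pi], continuous (fun x => xi x * (cos x * u x ^- 3))}.
  by apply: ctsM => //; apply: ctsM => //; exact: cts_cos.
have cj : {within `[0, pi], continuous j}.
  by apply: ctsD; apply: ctsM => //; exact: cts_cst.
have ij := continuous_intable cj.
pose J x := integ 0 x j.
have PJ : primitive 0 pi J j by split => // x _; rewrite /J integxx add0r.
have cJ := primitive_continuous (ltW pi0) PJ.
have [_ J0 Jpi] := (continuous_within_itvP J pi0).1 cJ.
have JpiE : J pi = 2 / k ^+ 2 * integ 0 pi (fun x => xi x * (cos x * u x ^- 3))
    - 3 * integ 0 pi (fun x => u x ^- 2).
  rewrite /J /j integD; last 2 first.
  - by apply: continuous_intable; apply: ctsM => //; exact: cts_cst.
  - by apply: continuous_intable; apply: ctsM => //; exact: cts_cst.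
  by rewrite !integZ ?mulNr//; exact: continuous_intable.
(* [G] is a primitive of the defect [g] defined below. The term
   [(b ^+ 2 - xi ^+ 2) / (k ^+ 2 * sin ^+ 2)] is integrated by parts against the cotangent, leaving
   the boundary term [c] and the first summand of [j]; the term [v ^+ 3 / r] of the AM-GM inequality
   is the derivative of [acos (xi / b)]. *)
pose c x := (b ^+ 2 - xi x ^+ 2) / sin x * cos x * (- k ^- 2).
pose B x := c x + J x.
pose G x := B x + 2 * k * acos (xi x / b).
have B0 : B x @[x --> 0^'+] --> (0 : R).
  rewrite -[X in _ --> X]addr0; apply: cvgD.
    by rewrite -[X in _ --> X](mul0r (- k ^- 2)); apply: cvgM => //; exact: cvg_cst.
  by move: J0; rewrite {2}/J integxx.
have Bpi : B x @[x --> pi^'-] --> J pi.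
  rewrite -[X in _ --> X]add0r; apply: cvgD => //.
  by rewrite -[X in _ --> X](mul0r (- k ^- 2)); apply: cvgM => //; exact: cvg_cst.
have q1 x : 0 < x < pi -> -1 < xi x / b < 1.
  move=> /xib /andP[h1 h2]; rewrite ltr_pdivlMr// mulN1r h1/=.
  by rewrite ltr_pdivrMr// mul1r.
have BG x : 0 < x < pi -> B x <= G x <= B x + 2 * k * pi.
  move=> /q1 /andP[/ltW h1 /ltW h2]; have k20 : 0 < 2 * k by rewrite mulr_gt0.
  rewrite lerDl lerD2l ler_pM2l// acos_lepi ?h1// andbT mulr_ge0 ?(ltW k20)//.
  by rewrite acos_ge0 ?h1.
(* [r] is the speed of the curve in the parameter [t] given by [xi = b cos t]: the arc length
   element is [rho dx], and [b sin t dt = sin x rho dx]. *)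
pose r x := Num.sqrt (b ^+ 2 - xi x ^+ 2) / sin x.
pose g x := r x ^+ 2 / k ^+ 2 + 2 * k * ((u x)^-1 ^+ 3 / r x) - 3 * (u x)^-1 ^+ 2.
have pos x : 0 < x < pi -> 0 < b ^+ 2 - xi x ^+ 2.
  by move=> /xib /andP[h1 h2]; nra.
have r0 x : 0 < x < pi -> 0 < r x.
  by move=> xpi; rewrite divr_gt0 ?sin_gt0_pi// sqrtr_gt0 pos.
have dG x : 0 < x < pi -> is_derive x 1 G (g x).
  move=> xpi; have sx : sin x != 0 by rewrite gt_eqF// sin_gt0_pi.
  pose S := Num.sqrt (b ^+ 2 - xi x ^+ 2).
  have S0 : 0 < S by rewrite sqrtr_gt0 pos.
  have S2 : S ^+ 2 = b ^+ 2 - xi x ^+ 2 by rewrite sqr_sqrtr// ltW// pos.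
  have SE : Num.sqrt (1 - (xi x / b) ^+ 2) = S / b.
    rewrite (_ : 1 - _ = (S / b) ^+ 2); first by rewrite sqrtr_sqr gtr0_norm// divr_gt0.
    by rewrite !expr_div_n S2; field; rewrite gt_eqF.
  have dacos := is_derive1_acos (q1 _ xpi).
  have dJ := primitive_is_derive PJ cj xpi.
  apply: (is_derive_eq (derD (derD (derM (derM (derM (derB (der_cst (b ^+ 2) x) (derX 2 (dxi _ xpi)))
     (derV (is_derive_sin x) sx)) (is_derive_cos x)) (der_cst (- k ^- 2) x)) dJ)
     (derM (der_cst (2 * k) x) (der_comp (derM (dxi _ xpi) (der_cst b^-1 x)) dacos)))).
  rewrite SE /g /r -/S /j expr1 /=.
  have -> : (S / sin x) ^+ 2 = (b ^+ 2 - xi x ^+ 2) / sin x ^+ 2 by rewrite expr_div_n S2.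
  apply/eqP; rewrite -subr_eq0; apply/eqP.
  transitivity ((b ^+ 2 - xi x ^+ 2) / (sin x ^+ 2 * k ^+ 2) * (cos x ^+ 2 + sin x ^+ 2 - 1)).
    by field; rewrite ?un0 ?sx ?gt_eqF.
  by rewrite cos2Dsin2 subrr mulr0.
have g0 x : 0 < x < pi -> 0 <= g x.
  by move=> xpi; have [] := am_gm3_defect k0 (r0 _ xpi) (v := (u x)^-1) _; rewrite ?invr_gt0.
have Gmono x y : 0 < x -> x <= y -> y < pi -> G x <= G y.
  move=> x0 xy ypi.
  have sub z : z \in `]0, pi[ -> 0 < z < pi by rewrite in_itv.
  apply: (@ger0_derive1_le_oo R G 0 pi).
  - by move=> z /sub /dG [].
  - by move=> z /sub zpi; rewrite derive1E; have [_ ->] := dG _ zpi; exact: g0.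
  - move=> z; rewrite inE/= => /sub /dG [dz _].
    by apply: differentiable_continuous; exact/derivable1_diffP.
  - by rewrite in_itv/= x0 (le_lt_trans xy).
  - by rewrite in_itv/= ypi (lt_le_trans x0).
  - exact: xy.
have sq := nondecreasing_increment_le pi0 B0 Bpi BG Gmono.
rewrite subr0 in sq.
split.
  (* The zero increment at [pi / 2] already yields [0 <= J pi + 2 * k * pi], which is the
     inequality. *)
  have h1 : 0 < pi / 2 :> R by rewrite divr_gt0.
  have h2 : pi / 2 < pi :> R by lra.
  by have := sq _ _ h1 (lexx _) h2; rewrite subrr JpiE; lra.
move=> eqJ.
(* In the equality case the bound on the increments of [G] is zero. Hence [G] is constant, its
   derivative [g] vanishes, and the equality case of AM-GM gives [r = k / u]. *)
have Gcst x y : 0 < x -> x <= y -> y < pi -> G y = G x.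
  move=> x0 xy ypi; apply/eqP; rewrite eq_le; apply/andP; split; last exact: Gmono.
  have := sq _ _ x0 xy ypi; rewrite JpiE; lra.
move=> x xpi; have /andP[x0 x1] := xpi.
have dG0 : is_derive x 1 G 0.
  apply: (near_eq_is_derive _ (der_cst (G x) x)); near=> y.
  have y0 : 0 < y by near: y; exact: lt_nbhsr.
  have y1 : y < pi by near: y; exact: lt_nbhsl.
  by have [xy|/ltW yx] := leP x y; [exact/esym/Gcst|exact: Gcst].
have gx0 : g x = 0.
  by have [_ <-] := dG _ xpi; have [_ ->] := dG0.
have v0 : 0 < (u x)^-1 by rewrite invr_gt0.
have [_ /(_ gx0) /(congr1 (fun z => z ^+ 2))] := am_gm3_defect k0 (r0 _ xpi) v0.
rewrite /r expr_div_n sqr_sqrtr ?(ltW (pos _ xpi))// => E.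
have sx : sin x != 0 by rewrite gt_eqF// sin_gt0_pi.
have -> : b ^+ 2 - xi x ^+ 2 = (k / u x) ^+ 2 * sin x ^+ 2.
  by rewrite -E divfK// expf_neq0.
by field.
Unshelve. all: by end_near. Qed.

(* The margin in the continuity hypothesis provides two-sided derivatives at the
   end points. *)
Lemma primitive_shift (R : realType) (a b c : R) (F f : R -> R) :
  a <= b -> {within `[a + c - 1, b + c + 1], continuous f} ->
  primitive (a + c) (b + c) F f ->
  primitive a b (fun x => F (x + c)) (fun x => f (x + c)).
Proof.
move=> ab cf [intf FE].
have cfc : {within `[a, b], continuous (fun x => f (x + c))}.
  apply: continuous_in_subspaceT => x; rewrite inE/= in_itv/= => /andP[ax xb].
  apply: (@continuous_comp _ _ _ (fun x => x + c) f).
    by apply: cvgD; [exact: cvg_id|exact: cvg_cst].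
  have lt : a + c - 1 < b + c + 1 by lra.
  by apply: (within_continuous_continuous lt cf); rewrite in_itv/=; apply/andP; split; lra.
pose P x := integ (a + c - 1) x f.
have PP : primitive (a + c - 1) (b + c + 1) P f.
  split; first exact: continuous_intable.
  by move=> x _; rewrite /P integxx add0r.
have dP x : a <= x <= b -> is_derive x 1 (fun y => P (y + c)) (f (x + c)).
  move=> /andP[ax xb].
  have xc : a + c - 1 < x + c < b + c + 1 by apply/andP; split; lra.
  have := der_comp (derD (der_id x) (der_cst c x)) (primitive_is_derive PP cf xc).
  by rewrite addr0 mulr1.
have PPc := derivable_primitiveT dP cfc.
split; first exact: continuous_intable.
move=> x /andP[ax xb].
rewrite (FE (x + c)); last by rewrite !lerD2r ax.
congr (_ + _).
rewrite -(primitiveE ax (primitiveS (lexx _) ax xb PPc)).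
have h1 : a + c - 1 <= a + c by lra.
have h2 : a + c <= x + c by lra.
have h3 : x + c <= b + c + 1 by lra.
by rewrite (primitiveE h2 (primitiveS h1 h2 h3 PP)).
Qed.

Lemma continuous_primitive (R : realType) (a b : R) (f : R -> R) :
  {within `[a, b], continuous f} -> primitive a b (fun x => integ a x f) f.
Proof.
by move=> cf; split; [exact: continuous_intable|move=> x _; rewrite integxx add0r].
Qed.

Lemma integ_shift (R : realType) (a b c : R) (f : R -> R) :
  a <= b -> {within `[a + c - 1, b + c + 1], continuous f} ->
  integ (a + c) (b + c) f = integ a b (fun x => f (x + c)).
Proof.
move=> ab cf.
have P : primitive (a + c) (b + c) (fun x => integ (a + c) x f) f.
  apply: continuous_primitive; apply: continuous_subspaceW cf.
  by apply: subset_itvScc; rewrite !bnd_simp; lra.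
by rewrite -(primitiveE ab (primitive_shift ab cf P)) integxx subr0.
Qed.

Lemma primitive_sin (R : realType) (a b : R) : primitive a b (@sin R) (@cos R).
Proof. by apply: derivable_primitiveT; exact: cts_cos. Qed.

Lemma primitive_cos (R : realType) (a b : R) : primitive a b (@cos R) (fun x => - sin x).
Proof.
by apply: derivable_primitiveT; apply: ctsN; exact: cts_sin.
Qed.

Lemma cos_2pi (R : realType) : cos (2 * pi) = 1 :> R.
Proof. by rewrite mulr_natl cos2pi. Qed.

Lemma sin_2pi (R : realType) : sin (2 * pi) = 0 :> R.
Proof. by rewrite mulr_natl sin2pi. Qed.

(** * Minkowski's inequality and the lower bound *)

(* Minkowski's inequality for the mixed area of [u] and the convex curve with
   support function [h = xi cos + Y sin]: a combination of [u], [h] and [cos]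
   vanishes at [0] and [pi], so that Wirtinger's inequality applies to it on
   both half circles. *)
Lemma circle_minkowski (R : realType) (b s : R) (u g xi : R -> R) :
  0 < b -> (forall x, 0 < u x) -> primitive 0 (2 * pi) u g ->
  intable 0 (2 * pi) (fun x => g x ^+ 2) -> u (2 * pi) = u 0 ->
  integ 0 (2 * pi) (fun x => cos x * u x ^- 3) = 0 ->
  xi 0 = b -> xi pi = - b -> xi (2 * pi) = b ->
  primitive 0 (2 * pi) xi (fun x => - (sin x * u x ^- 3)) ->
  s = (u 0 + u pi) / (2 * b) ->
  0 <= integ 0 (2 * pi) (fun x => g x ^+ 2) - integ 0 (2 * pi) (fun x => u x ^+ 2)
    + 2 * s * integ 0 (2 * pi) (fun x => u x ^- 2)
    - 2 * s ^+ 2 * integ 0 (2 * pi) (fun x => xi x * (cos x * u x ^- 3)).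
Proof.
move=> b0 u0 Pu ig2 uper ocos xi0 xipi xi2pi Pxi sE.
have pi0 := @pi_gt0 R.
have ab : 0 <= 2 * pi :> R by rewrite mulr_ge0// ltW.
have un0 x : u x != 0 by rewrite gt_eqF.
have cu := primitive_continuous ab Pu; have cxi := primitive_continuous ab Pxi.
have cun n : {within `[0, 2 * pi], continuous (fun x => u x ^- n)}.
  have cmu : {within `[0, 2 * pi], continuous (fun x => u x ^+ n)} by exact: ctsX.
  by apply: (ctsV (f := fun x => u x ^+ n)) => // x; rewrite expf_neq0.
have cY' : {within `[0, 2 * pi], continuous (fun x => cos x * u x ^- 3)}.
  by apply: ctsM => //; exact: cts_cos.
pose Y x := integ 0 x (fun x => cos x * u x ^- 3).
have PY : primitive 0 (2 * pi) Y (fun x => cos x * u x ^- 3) by exact: continuous_primitive.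
have Y0 : Y 0 = 0 by rewrite /Y integxx.
have Y2pi : Y (2 * pi) = 0 by rewrite /Y ocos.
have Ps := @primitive_sin R 0 (2 * pi); have Pc := @primitive_cos R 0 (2 * pi).
have cY := primitive_continuous ab PY.
pose h x := xi x * cos x + Y x * sin x.
pose h' x := - (xi x * sin x) + Y x * cos x.
have Ph : primitive 0 (2 * pi) h h'.
  apply: eq_primitive (primitiveD (primitiveM ab Pxi Pc) (primitiveM ab PY Ps)) => // x.
  by rewrite /h'; ring.
have Ph' : primitive 0 (2 * pi) h' (fun x => u x ^- 3 - h x).
  apply: eq_primitive (primitiveD (primitiveZ (-1) (primitiveM ab Pxi Ps)) (primitiveM ab PY Pc)) => x.
    by rewrite /h'; ring.
  rewrite /h; apply/eqP; rewrite -subr_eq0; apply/eqP.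
  transitivity (u x ^- 3 * (cos x ^+ 2 + sin x ^+ 2 - 1)); first ring.
  by rewrite cos2Dsin2 subrr mulr0.
have ch := primitive_continuous ab Ph; have ch' := primitive_continuous ab Ph'.
(* [h] equals [b] at both 0 and [pi], so [s * h] matches the mean of [u 0] and [u pi]; [be * cos]
   matches their half difference. *)
pose be := (u 0 - u pi) / 2.
pose w x := u x + ((- s) * h x + (- be) * cos x).
pose w' x := g x + ((- s) * h' x + (- be) * - sin x).
have Pw : primitive 0 (2 * pi) w w'.
  by apply: primitiveD => //; apply: primitiveD; apply: primitiveZ.
have w0 : w 0 = 0.
  by rewrite /w /h xi0 Y0 cos0 sin0 sE /be; field; rewrite gt_eqF.
have wpi : w pi = 0.
  by rewrite /w /h xipi sinpi cospi sE /be; field; rewrite gt_eqF.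
have w2pi : w (2 * pi) = 0.
  by rewrite /w /h xi2pi Y2pi cos_2pi sin_2pi uper sE /be; field; rewrite gt_eqF.
pose v x := (- s) * h' x + (- be) * - sin x.
have cv : {within `[0, 2 * pi], continuous v}.
  by apply: ctsD; apply: ctsM => //; [exact: cts_cst|exact: cts_cst|apply: ctsN; exact: cts_sin].
have [ig _] := Pu.
have iw'2 : intable 0 (2 * pi) (fun x => w' x ^+ 2).
  rewrite (_ : (fun x => _) = (fun x => g x ^+ 2 + (g x * (2 * v x) + v x ^+ 2))).
    apply: intableD => //; apply: intableD.
      by apply: intableM => //; apply: ctsM => //; exact: cts_cst.
    by apply: continuous_intable; exact: ctsX.
  by apply/funext => x; rewrite /w' -/(v x); ring.
have cw := primitive_continuous ab Pw.
have iw2 : intable 0 (2 * pi) (fun x => w x ^+ 2).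
  by apply: continuous_intable; exact: ctsX.
have le1 : integ 0 (2 * pi) (fun x => w x ^+ 2) <= integ 0 (2 * pi) (fun x => w' x ^+ 2).
  have hpi1 : 0 <= pi :> R by exact: ltW.
  have hpi2 : pi <= 2 * pi :> R by lra.
  have hpi : ((0 : R) <= pi) && (pi <= 2 * pi :> R) by rewrite hpi1 hpi2.
  rewrite (integ_cat hpi iw2) (integ_cat hpi iw'2); apply: lerD.
    have := @wirtinger R 0 w w'; rewrite add0r; apply => //.
      exact: primitiveS Pw.
    exact: intableS iw'2.
  have := @wirtinger R pi w w'; rewrite (_ : pi + pi = 2 * pi); last ring.
  apply => //; first exact: primitiveS Pw.
  exact: intableS iw'2.
(* These are the exact terms in the expansion of [w' ^+ 2 - w ^+ 2]. Modulo exact terms,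
   [h'' + h = u ^- 3] turns the cross term of [u] and [h] into [2 * s * u ^- 2], and
   [h' ^+ 2 - h ^+ 2] into [-2 * xi * cos * u ^- 3]. Each primitive takes the same value at 0 and
   [2 * pi]. *)
have PT := primitiveD (primitiveD (primitiveD (primitiveD
  (primitiveZ (s ^+ 2) (primitiveD (primitiveM ab Ph Ph') (primitiveM ab Pxi PY)))
  (primitiveZ (- be ^+ 2) (primitiveM ab Ps Pc)))
  (primitiveZ (-2 * s) (primitiveM ab Pu Ph')))
  (primitiveZ (2 * be) (primitiveM ab Pu Ps)))
  (primitiveZ (-2 * s * be) (primitiveM ab Ph Ps)).
have := primitiveE ab PT.
have [iT _] := PT.
have h0 : h 0 = b by rewrite /h xi0 Y0 cos0 sin0; ring.
have h2pi : h (2 * pi) = b by rewrite /h xi2pi Y2pi cos_2pi sin_2pi; ring.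
have h'0 : h' 0 = 0 by rewrite /h' Y0 sin0; ring.
have h'2pi : h' (2 * pi) = 0 by rewrite /h' Y2pi sin_2pi; ring.
rewrite h0 h2pi h'0 h'2pi Y0 Y2pi xi0 xi2pi cos_2pi sin_2pi cos0 sin0 uper.
set T' := (X in integ _ _ X) => T0.
have {T0} T0 : integ 0 (2 * pi) T' = 0 by rewrite -T0; ring.
have iu2 : intable 0 (2 * pi) (fun x => u x ^+ 2) by apply: continuous_intable; exact: ctsX.
have ium2 : intable 0 (2 * pi) (fun x => u x ^- 2) by exact: continuous_intable.
have ixc : intable 0 (2 * pi) (fun x => xi x * (cos x * u x ^- 3)).
  by apply: continuous_intable; exact: ctsM.
have i1 := intableZ (-1) iu2; have i2 := intableZ (2 * s) ium2.
have i3 := intableZ (- (2 * s ^+ 2)) ixc.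
have i12 := intableD ig2 i1.
have i4 := intableD i12 i2.
have i5 := intableD i4 i3.
have i6 := intableD i5 iT.
have : 0 <= integ 0 (2 * pi) (fun x => w' x ^+ 2 + (-1) * w x ^+ 2).
  by rewrite integD ?integZ ?mulN1r ?subr_ge0//; exact: intableZ.
rewrite (_ : integ _ _ (fun x => w' x ^+ 2 + _) = integ 0 (2 * pi) (fun x =>
  g x ^+ 2 + (-1) * u x ^+ 2 + (2 * s) * u x ^- 2 +
  (- (2 * s ^+ 2)) * (xi x * (cos x * u x ^- 3)) + T' x)); last first.
  apply: eq_integ => x _; rewrite /T' /w /w' /h /h'.
  by field; rewrite un0.
rewrite (integD i5 iT) (integD i4 i3) (integD i12 i2) (integD ig2 i1) !integZ// T0.
by rewrite addr0 mulN1r mulNr.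
Qed.

Lemma integ_gt0 (R : realType) (a b : R) (f : R -> R) : a < b ->
  {within `[a, b], continuous f} -> (forall x, a < x < b -> 0 < f x) ->
  0 < integ a b f.
Proof.
move=> ab cf f0; have P := continuous_primitive cf.
rewrite -[X in X < _](integxx a f).
have dP x : a < x < b -> is_derive x 1 _ _ := primitive_is_derive P cf.
apply: (@gtr0_derive1_lt_cc R (fun x => integ a x f) a b) => //; rewrite ?in_itv/= ?lexx ?(ltW ab)//.
- by move=> x; rewrite in_itv/= => /dP[].
- by move=> x; rewrite in_itv/= => xab; rewrite derive1E; have [_ ->] := dP _ xab; exact: f0.
- exact: primitive_continuous (ltW ab) P.
Qed.

(** Completing the square in [s * Om ^+ 2] writes [E * Om + 4 * p ^+ 2] as a positive combination of
    the defects of both inequalities plus a square. When it is zero, the isoperimetric defect, whose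
    coefficient is positive, is zero. *)
Lemma minkowski_isoperimetric (R : realType) (p s E Om A : R) : 0 < p -> 0 < s -> 0 < Om ->
  0 <= E + 2 * s * Om - 2 * s ^+ 2 * A -> Om ^+ 3 <= 8 * p ^+ 2 * A ->
  - (4 * p ^+ 2) <= E * Om /\
  (E * Om = - (4 * p ^+ 2) -> Om ^+ 3 = 8 * p ^+ 2 * A).
Proof.
move=> p0 s0 Om0 H1 H2.
pose d := E + 2 * s * Om - 2 * s ^+ 2 * A; pose e := 8 * p ^+ 2 * A - Om ^+ 3.
have d0 : 0 <= d by [].
have e0 : 0 <= e by rewrite subr_ge0.
have c0 : 0 < s ^+ 2 * Om / (4 * p ^+ 2) by rewrite divr_gt0 ?mulr_gt0 ?exprn_gt0.
have key : E * Om + 4 * p ^+ 2 =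
    d * Om + s ^+ 2 * Om / (4 * p ^+ 2) * e + (s * Om ^+ 2 / (2 * p) - 2 * p) ^+ 2.
  by rewrite /d /e; field; rewrite gt_eqF.
have t1 : 0 <= d * Om by rewrite mulr_ge0// ltW.
have t2 : 0 <= s ^+ 2 * Om / (4 * p ^+ 2) * e by rewrite mulr_ge0// ltW.
have t3 := sqr_ge0 (s * Om ^+ 2 / (2 * p) - 2 * p).
split; first lra.
move=> eq0; have : s ^+ 2 * Om / (4 * p ^+ 2) * e = 0 by lra.
move/eqP; rewrite mulf_eq0 (gt_eqF c0) /= subr_eq0 => /eqP ->//.
Qed.

Lemma periodic2pi_sin (R : realType) (x : R) : sin (x + 2 * pi) = sin x.
Proof. by rewrite mulr_natl sinD2pi. Qed.

Lemma periodic2pi_cos (R : realType) (x : R) : cos (x + 2 * pi) = cos x.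
Proof. by rewrite mulr_natl cosD2pi. Qed.

(* [xi] is the centred abscissa of the curve with radius of curvature [u^-3];
   the last equation is the equality case of [half_circle_ineq]. *)
Definition extremal_arc (R : realType) (b k : R) (u xi : R -> R) : Prop :=
  forall x, 0 < x < pi -> [/\ - b < xi x < b,
    is_derive x 1 xi (- (sin x * u x ^- 3)) &
    (b ^+ 2 - xi x ^+ 2) * u x ^+ 2 = k ^+ 2 * sin x ^+ 2].

(** [half_circle_ineq] is applied on [0, pi] and, after a half turn, on [pi, 2 pi] with the same [b]
    and [k]. The sum is the affine isoperimetric inequality, to be combined with [circle_minkowski].
    Global equality forces equality on both halves. *)
Lemma circle_ineq (R : realType) (u g : R -> R) :
  continuous u -> (forall x, 0 < u x) -> periodic u (2 * pi) ->
  primitive 0 (2 * pi) u g -> intable 0 (2 * pi) (fun x => g x ^+ 2) ->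
  integ 0 (2 * pi) (fun x => cos x * u x ^- 3) = 0 ->
  integ 0 (2 * pi) (fun x => sin x * u x ^- 3) = 0 ->
  let D := (integ 0 (2 * pi) (fun x => g x ^+ 2) - integ 0 (2 * pi) (fun x => u x ^+ 2))
    * integ 0 (2 * pi) (fun x => u x ^- 2) in
  - (4 * pi ^+ 2) <= D /\
  (D = - (4 * pi ^+ 2) -> exists (b k : R) (xi1 xi2 : R -> R),
    [/\ 0 < b, 0 < k, extremal_arc b k u xi1 &
        extremal_arc b k (fun x => u (x + pi)) xi2]).
Proof.
move=> cu u0 uper Pu ig2 ocos osin D.
have pi0 := @pi_gt0 R.
have ab : 0 <= 2 * pi :> R by rewrite mulr_ge0// ltW.
have un0 x : u x != 0 by rewrite gt_eqF.
have cun n (A : set R) : {within A, continuous (fun x => u x ^- n)}.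
  have cmu : {within A, continuous (fun x => u x ^+ n)} by apply: ctsX; exact: continuous_subspaceT.
  by apply: (ctsV (f := fun x => u x ^+ n)) => // x; rewrite expf_neq0.
have rho0 n x : 0 < u x ^- n by rewrite invr_gt0 exprn_gt0.
pose f x := - (sin x * u x ^- 3).
have cf (A : set R) : {within A, continuous f}.
  by apply: ctsN; apply: ctsM => //; exact: cts_sin.
(* Half the drop of the abscissa over [0, pi]; the constant in [xi] then centres it, so that it runs
   from [b] to [- b]. *)
pose b := - (integ 0 pi f) / 2.
(* Integrating from -1 makes [xi] continuous on a margin around [0, 2 pi], as [integ_shift]
   requires. *)
pose xi x := (b - integ (-1) 0 f) + integ (-1) x f.
have PXi : primitive (-1) (2 * pi + 1) xi f.
  split; first by apply: continuous_intable.
  by move=> x _; rewrite /xi integxx addr0.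
have Pxi : primitive 0 (2 * pi) xi f by apply: primitiveS PXi => //; lra.
have xi0 : xi 0 = b by rewrite /xi subrK.
have hpi2 : pi <= 2 * pi :> R by lra.
have Pxi1 : primitive 0 pi xi f by apply: primitiveS Pxi => //; exact: ltW.
have xipi : xi pi = - b.
  by apply: (addIr (- xi 0)); rewrite (primitiveE (ltW pi0) Pxi1) xi0 /b; field.
have xi2pi : xi (2 * pi) = b.
  apply: (addIr (- xi 0)); rewrite (primitiveE ab Pxi) xi0 subrr.
  rewrite (_ : integ _ _ _ = integ 0 (2 * pi) (fun x => (-1) * (sin x * u x ^- 3))).
    by rewrite integZ ?osin ?mulr0//; apply: continuous_intable; apply: ctsM => //; exact: cts_sin.
  by apply: eq_integ => x _; rewrite /f mulN1r.
have xib := half_circle_bounds (cun 3 _) (rho0 3) xi0 xipi Pxi1.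
have b0 : 0 < b.
  have : (0 < pi / 2 :> R) && (pi / 2 < pi :> R) by apply/andP; split; lra.
  by move=> /xib/andP[]; lra.
pose Om := integ 0 (2 * pi) (fun x => u x ^- 2).
have Om0 : 0 < Om by apply: integ_gt0 => //; rewrite mulr_gt0.
(* With this [k] the terms [2 * k * pi] of the two halves add up to [2 * Om], and the summed
   inequality becomes [Om <= 8 * pi ^+ 2 * A / Om ^+ 2]. *)
pose k := Om / (2 * pi).
have k0 : 0 < k by rewrite divr_gt0// mulr_gt0.
have [H1 E1] := half_circle_ineq b0 k0 cu u0 xi0 xipi Pxi1.
(* A shift by [pi] changes the sign of [sin] and [cos]; the sign in [xi2] restores the equation of
   [xi] and the end values [b] and [- b]. *)
pose u2 x := u (x + pi); pose xi2 x := - xi (x + pi).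
have cu2 : continuous u2 by exact: continuous_shift.
have Pxi2 : primitive 0 pi xi2 (fun x => - (sin x * u2 x ^- 3)).
  have P1 : primitive (0 + pi) (pi + pi) xi f.
    by apply: primitiveS Pxi; rewrite ?add0r//; lra.
  apply: eq_primitive (primitiveZ (-1) (primitive_shift (ltW pi0) (cf _) P1)) => x.
    by rewrite mulN1r.
  by rewrite /f sinDpi /u2; ring.
have xi20 : xi2 0 = b by rewrite /xi2 add0r xipi opprK.
have xi2pi' : xi2 pi = - b by rewrite /xi2 (_ : pi + pi = 2 * pi) ?xi2pi//; ring.
have crho2 : {within `[0, pi], continuous (fun x => u2 x ^- 3)}.
  apply: (ctsV (f := fun x => u2 x ^+ 3)) => [x|]; first by rewrite expf_neq0// un0.
  by apply: ctsX; exact: continuous_subspaceT.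
have cf2 : {within `[0, pi], continuous (fun x => - (sin x * u2 x ^- 3))}.
  by apply: ctsN; apply: ctsM => //; exact: cts_sin.
have xib2 := half_circle_bounds crho2 (fun x => rho0 3 (x + pi)) xi20 xi2pi' Pxi2.
have [H2 E2] := half_circle_ineq b0 k0 cu2 (fun x => u0 (x + pi)) xi20 xi2pi' Pxi2.
have hpi : ((0 : R) <= pi) && (pi <= 2 * pi :> R) by rewrite ltW.
have pipi : (pi + pi : R) = 2 * pi by ring.
have cxiw : {within `[-1, 2 * pi + 1], continuous xi}.
  by apply: primitive_continuous PXi; lra.
pose F x := xi x * (cos x * u x ^- 3).
have cF : {within `[-1, 2 * pi + 1], continuous F}.
  by apply: ctsM => //; apply: ctsM => //; exact: cts_cos.
have iF : intable 0 (2 * pi) F.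
  by apply: (@intableS _ (-1) (2 * pi + 1)); [lra|lra|exact: continuous_intable].
pose A := integ 0 (2 * pi) F.
have OmE : Om = integ 0 pi (fun x => u x ^- 2) + integ 0 pi (fun x => u2 x ^- 2).
  rewrite /Om (integ_cat hpi); last exact: continuous_intable.
  congr (_ + _); rewrite -(integ_shift (f := fun x => u x ^- 2) (ltW pi0)) ?add0r ?pipi//.
have AE : A = integ 0 pi F + integ 0 pi (fun x => xi2 x * (cos x * u2 x ^- 3)).
  rewrite /A (integ_cat hpi)//; congr (_ + _).
  rewrite (_ : integ 0 pi _ = integ 0 pi (fun x => F (x + pi))).
    rewrite -(integ_shift (f := F) (ltW pi0)) ?add0r ?pipi//.
    by apply: continuous_subspaceW cF; apply: subset_itvScc; rewrite !bnd_simp; lra.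
  by apply: eq_integ => x _; rewrite /F /xi2 /u2 cosDpi; ring.
(* [pi] is generalized because [field] unfolds it. *)
have k2 : 2 / k ^+ 2 = 8 * pi ^+ 2 / Om ^+ 2.
  have gen (p : R) : 0 < p -> 2 / (Om / (2 * p)) ^+ 2 = 8 * p ^+ 2 / Om ^+ 2.
    by move=> p0; field; rewrite !gt_eqF.
  exact: gen.
have kOm : 2 * k * pi = Om.
  have gen (p : R) : 0 < p -> 2 * (Om / (2 * p)) * p = Om by move=> p0; field; rewrite gt_eqF.
  exact: gen.
have sum : 3 * Om <= 2 / k ^+ 2 * A + 2 * Om.
  by rewrite OmE AE mulrDr; rewrite -/F in H1; lra.
have OmA : Om ^+ 3 <= 8 * pi ^+ 2 * A.
  have : Om <= 8 * pi ^+ 2 * A / Om ^+ 2 by move: sum; rewrite k2 mulrAC; lra.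
  by rewrite ler_pdivlMr ?exprn_gt0// -exprS.
pose s := (u 0 + u pi) / (2 * b).
have s0 : 0 < s by apply: divr_gt0; [exact: addr_gt0|exact: mulr_gt0].
have u2pi : u (2 * pi) = u 0 by rewrite -(uper 0) add0r.
have HA := circle_minkowski b0 u0 Pu ig2 u2pi ocos xi0 xipi xi2pi Pxi (erefl s).
have [HI HE] := minkowski_isoperimetric pi0 s0 Om0 HA OmA.
split => // /HE OmAE.
have sumE : Om = 2 / k ^+ 2 * A by rewrite k2 mulrAC -OmAE; field; rewrite gt_eqF.
have dxi x : 0 < x < pi -> is_derive x 1 xi (f x).
  by move=> xpi; apply: primitive_is_derive Pxi1 (cf _) xpi.
have sumE' : 3 * Om = 2 / k ^+ 2 * A + 2 * Om by rewrite -sumE; ring.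
rewrite OmE AE mulrDr -OmE in sumE'; rewrite -/F in H1 E1.
move: sumE' H1 H2 E1 E2; set I1 := integ _ _ F; set I2 := integ 0 pi (fun x => xi2 x * _).
set J1 := integ 0 pi _; set J2 := integ 0 pi _; move=> sumE' H1 H2 E1 E2.
(* [H1] and [H2] add up to the equality [sumE'], so each of them is an equality. *)
have {}E1 : forall x, 0 < x < pi -> (b ^+ 2 - xi x ^+ 2) * u x ^+ 2 = k ^+ 2 * sin x ^+ 2.
  by apply: E1; apply/eqP; rewrite eq_le H1 /=; lra.
have {}E2 : forall x, 0 < x < pi -> (b ^+ 2 - xi2 x ^+ 2) * u2 x ^+ 2 = k ^+ 2 * sin x ^+ 2.
  by apply: E2; apply/eqP; rewrite eq_le H2 /=; lra.
exists b, k, xi, xi2; split; [exact: b0|exact: k0| |].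
- by move=> x xpi; split; [exact: xib|exact: dxi|exact: E1].
- by move=> x xpi; split; [exact: xib2|exact: (primitive_is_derive Pxi2 cf2)|exact: E2].
Qed.

(** * The equality case *)

Lemma derive0_cst_oo (R : realType) (a b : R) (f : R -> R) :
  (forall x, a < x < b -> is_derive x 1 f 0) ->
  forall x y, a < x < b -> a < y < b -> f x = f y.
Proof.
move=> df.
have wlog_le x y : a < x < b -> a < y < b -> x <= y -> f x = f y.
  move=> xab yab xy.
  have df' z : z \in `]a, b[ -> derivable f z 1 by rewrite in_itv/= => /df[].
  have cf : {in `]a, b[%classic, continuous f}.
    move=> z; rewrite inE/= => zab; apply: differentiable_continuous.
    by apply/derivable1_diffP; exact: df'.
  have dz z : z \in `]a, b[ -> derive1 f z = 0.
    by rewrite in_itv/= => /df[_]; rewrite derive1E.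
  apply/eqP; rewrite eq_le; apply/andP; split.
    by apply: (ger0_derive1_le_oo df' _ cf); rewrite ?in_itv// => z /dz ->.
  by apply: (ler0_derive1_le_oo df' _ cf); rewrite ?in_itv// => z /dz ->.
move=> x y xab yab; have [xy|/ltW yx] := leP x y; first exact: wlog_le.
by rewrite (wlog_le _ _ yab xab yx).
Qed.

(** The symmetric form with diagonal entries [p], [q] and off-diagonal entry [r], evaluated on the
    unit circle; its determinant is [p * q - r ^+ 2]. *)
Definition quadratic (R : realType) (p r q x : R) : R :=
  p * cos x ^+ 2 + 2 * r * (sin x * cos x) + q * sin x ^+ 2.

(* The quantity [xi / sqrt (b^2 - xi^2)] has derivative [- (b^2 / k^3) / sin^2]
   along an extremal arc, hence is affine in the cotangent. *)
Lemma extremal_arc_quadratic (R : realType) (b k : R) (u xi : R -> R) :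
  0 < b -> 0 < k -> (forall x, 0 < u x) -> extremal_arc b k u xi ->
  exists C, forall x, 0 < x < pi ->
    u x ^+ 2 = quadratic (b ^+ 2 / k ^+ 4) (C / k) (k ^+ 2 / b ^+ 2 * (1 + C ^+ 2)) x.
Proof.
move=> b0 k0 u0 arc.
pose S x := Num.sqrt (b ^+ 2 - xi x ^+ 2).
have pos x : 0 < x < pi -> 0 < b ^+ 2 - xi x ^+ 2.
  by move=> /arc[/andP[h1 h2] _ _]; nra.
have S0 x : 0 < x < pi -> 0 < S x by move=> /pos h; rewrite sqrtr_gt0.
have S2 x : 0 < x < pi -> S x ^+ 2 = b ^+ 2 - xi x ^+ 2.
  by move=> /pos /ltW h; rewrite sqr_sqrtr.
have s0 (x : R) : 0 < x < pi -> 0 < sin x by exact: sin_gt0_pi.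
have uE x : 0 < x < pi -> u x = k * sin x / S x.
  move=> xpi; have [_ _ E] := arc _ xpi; have := S0 _ xpi => Sx; have sx := s0 _ xpi.
  apply: (pexpIrn (n := 2)) => //; rewrite ?nnegrE ?ltW//.
    by rewrite divr_gt0 ?mulr_gt0.
  rewrite expr_div_n S2// exprMn -E mulrAC divff ?mul1r//.
  by rewrite gt_eqF// pos.
pose D x := xi x / S x - b ^+ 2 / k ^+ 3 * (cos x / sin x).
have dD x : 0 < x < pi -> is_derive x 1 D 0.
  move=> xpi; have [_ dxi _] := arc _ xpi.
  have := S0 _ xpi => Sx; have sx := s0 _ xpi; have ux := uE _ xpi.
  have dS := der_sqrt (derB (der_cst (b ^+ 2) x) (derX 2 dxi)) (pos _ xpi).
  have Sn : Num.sqrt (b ^+ 2 - xi x ^+ 2) != 0 by rewrite gt_eqF.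
  apply: (is_derive_eq (derB (derM dxi (derV dS Sn)) (derM (der_cst (b ^+ 2 / k ^+ 3) x)
    (derM (is_derive_cos x) (derV (is_derive_sin x) (lt0r_neq0 sx)))))).
  rewrite -/(S x) ux /= expr1.
  transitivity ((S x ^+ 2 - (b ^+ 2 - xi x ^+ 2)) * (- 1 / (k ^+ 3 * sin x ^+ 2))
    + b ^+ 2 / (k ^+ 3 * sin x ^+ 2) * (cos x ^+ 2 + sin x ^+ 2 - 1)).
    by field; rewrite !gt_eqF.
  by rewrite S2// subrr mul0r add0r cos2Dsin2 subrr mulr0.
pose C := D (pi / 2).
have pi0 := @pi_gt0 R.
exists C => x xpi.
have DC : D x = C.
  by apply: (derive0_cst_oo dD) => //; apply/andP; split; lra.
have Sx := S0 _ xpi; have sx := s0 _ xpi.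
have eta : xi x = S x * (b ^+ 2 / k ^+ 3 * (cos x / sin x) + C).
  by rewrite -DC /D addrCA subrr addr0 mulrCA divff ?mulr1// gt_eqF.
have e1 := S2 _ xpi; rewrite eta exprMn in e1.
(* Here [t = xi / S], so [S ^+ 2 * (1 + t ^+ 2) = b ^+ 2]. Then [u ^+ 2 = k ^+ 2 * sin ^+ 2 * (1 + t
   ^+ 2) / b ^+ 2], a quadratic form because [t] is affine in the cotangent. *)
set t := b ^+ 2 / k ^+ 3 * (cos x / sin x) + C in e1.
have e2 : (S x ^+ 2)^-1 = (1 + t ^+ 2) / b ^+ 2.
  have : S x ^+ 2 * (1 + t ^+ 2) = b ^+ 2 by rewrite mulrDr mulr1 {1}e1 subrK.
  move=> <-; have t0 : 0 < 1 + t ^+ 2 by rewrite ltr_pwDl ?sqr_ge0.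
  by field; rewrite !gt_eqF.
by rewrite (uE _ xpi) expr_div_n e2 /t /quadratic; field; rewrite !gt_eqF.
Qed.

Lemma quadratic_derive (R : realType) (p r q x : R) :
  is_derive x 1 (quadratic p r q)
    (2 * (q - p) * (sin x * cos x) + 2 * r * (cos x ^+ 2 - sin x ^+ 2)).
Proof.
have dc := is_derive_cos x; have ds := is_derive_sin x.
apply: (is_derive_eq (derD (derD (derM (der_cst p x) (derX 2 dc))
  (derM (der_cst (2 * r) x) (derM ds dc))) (derM (der_cst q x) (derX 2 ds)))).
by rewrite /= !expr1; ring.
Qed.

Lemma quadratic_continuous (R : realType) (p r q : R) : continuous (quadratic p r q).
Proof.
move=> x; apply: differentiable_continuous; apply/derivable1_diffP.
by have [] := quadratic_derive p r q x.
Qed.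

Lemma quadratic_pi (R : realType) (p r q x : R) :
  quadratic p r q (x + pi) = quadratic p r q x.
Proof. by rewrite /quadratic sinDpi cosDpi; ring. Qed.

Lemma derive_sqrt_quadratic (R : realType) (p r q x : R) (u : R -> R) :
  (forall x, 0 < u x) -> (\forall y \near x, u y ^+ 2 = quadratic p r q y) ->
  is_derive x 1 u
   (((q - p) * (sin x * cos x) + r * (cos x ^+ 2 - sin x ^+ 2)) / u x).
Proof.
move=> u0 uQ; have ux := nbhs_singleton uQ.
have sq : Num.sqrt (quadratic p r q x) = u x by rewrite -ux sqrtr_sqr gtr0_norm.
have Q0 : 0 < quadratic p r q x by rewrite -ux exprn_gt0.
apply: (near_eq_is_derive _ (is_derive_eq (der_sqrt (quadratic_derive p r q x) Q0) _)).
  near=> y; have -> : quadratic p r q y = u y ^+ 2 by apply/esym; near: y.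
  by rewrite sqrtr_sqr gtr0_norm.
by rewrite sq; field; rewrite gt_eqF.
Unshelve. all: by end_near. Qed.

(** The linear form [r cos + q sin], divided by [d * u], is a primitive of the integrand. The
    closing condition on a half circle thereby reads off the off-diagonal coefficient [r]. *)
Lemma integ_cos_quadratic (R : realType) (p r q d : R) (u : R -> R) :
  d != 0 -> p * q - r ^+ 2 = d ->
  continuous u -> (forall x, 0 < u x) ->
  (forall x, 0 < x < pi -> u x ^+ 2 = quadratic p r q x) ->
  integ 0 pi (fun x => cos x * u x ^- 3) = - (r / d) * ((u 0)^-1 + (u pi)^-1).
Proof.
move=> d0 dE cu u0 uQ; have pi0 := @pi_gt0 R.
have un0 x : u x != 0 by rewrite gt_eqF.
have cuw : {within `[0, pi], continuous u} by exact: continuous_subspaceT.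
have ccu : {within `[0, pi], continuous (fun x => cos x * u x ^- 3)}.
  apply: ctsM; first exact: cts_cos.
  by apply: (ctsV (f := fun x => u x ^+ 3)) => [x|]; [rewrite expf_neq0|exact: ctsX].
pose F x := (r * cos x + q * sin x) * (u x)^-1 * d^-1.
have cF : {within `[0, pi], continuous F}.
  apply: ctsM; last exact: cts_cst.
  apply: ctsM; last exact: ctsV.
  by apply: ctsD; (apply: ctsM; [exact: cts_cst|]); [exact: cts_cos|exact: cts_sin].
have P : primitive 0 pi F (fun x => cos x * u x ^- 3).
  apply: derivable_primitive; [exact: cF|exact: ccu|move=> x xpi].
  have [x0 x1] := andP xpi.
  have uQx : \forall y \near x, u y ^+ 2 = quadratic p r q y.
    near=> y; apply: uQ; apply/andP; split.
      by near: y; exact: lt_nbhsr.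
    by near: y; exact: lt_nbhsl.
  apply: (is_derive_eq (derM (derM (derD (derM (der_cst r x) (is_derive_cos x))
    (derM (der_cst q x) (is_derive_sin x))) (derV (derive_sqrt_quadratic u0 uQx) (un0 x)))
    (der_cst d^-1 x))).
  have ux := uQ _ xpi.
  transitivity (((q * cos x - r * sin x) * u x ^+ 2 -
    (r * cos x + q * sin x) * ((q - p) * (sin x * cos x) + r * (cos x ^+ 2 - sin x ^+ 2)))
    / (u x ^+ 3 * d)).
    by field; rewrite ?un0 ?d0.
  rewrite ux /quadratic.
  transitivity ((p * q - r ^+ 2) * (cos x ^+ 2 + sin x ^+ 2) * cos x / (u x ^+ 3 * d)).
    by congr (_ / _); ring.
  by rewrite dE cos2Dsin2; field; rewrite ?un0 ?d0.
rewrite -(primitiveE (ltW pi0) P) /F cospi cos0 sinpi sin0; ring.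
Unshelve. all: by end_near. Qed.

Lemma continuous_eq_left (R : realType) (a b : R) (f g : R -> R) : a < b ->
  continuous f -> continuous g -> (forall x, a < x < b -> f x = g x) -> f a = g a.
Proof.
move=> ab cf cg fg.
have fa : f x - g x @[x --> a^'+] --> f a - g a.
  by apply: cvg_at_right_filter; apply: cvgB; [exact: cf|exact: cg].
have H : \forall x \near a^'+, f x - g x = 0.
  near=> x; rewrite fg ?subrr//; apply/andP; split.
    by near: x; exact: nbhs_right_gt.
  by near: x; exact: nbhs_right_lt.
have h1 : 0 <= f a - g a by apply: (cvgr_to_ge fa); apply: filterS H => x ->.
have h2 : f a - g a <= 0 by apply: (cvgr_to_le fa); apply: filterS H => x ->.
lra.
Unshelve. all: by end_near. Qed.

Lemma periodic_eq (R : realType) (T : R) (f g : R -> R) : 0 < T ->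
  periodic f T -> periodic g T -> (forall x, 0 <= x < T -> f x = g x) ->
  forall x, f x = g x.
Proof.
move=> T0 pf pg fg x.
have shiftn (h : R -> R) (ph : periodic h T) (n : nat) a : h (a + n%:R * T) = h a.
  by rewrite mulr_natl; exact: periodicn.
have shiftz (h : R -> R) (ph : periodic h T) (z : int) a : h (a + z%:~R * T) = h a.
  case: z => n; first exact: shiftn.
  rewrite NegzE mulrNz mulNr; set b := a - _.
  by rewrite -(shiftn h ph n.+1 b) /b subrK.
pose z := Num.floor (x / T).
have zx : x = (x - z%:~R * T) + z%:~R * T by rewrite subrK.
rewrite zx !shiftz//; apply: fg.
have /andP[] := floor_itv (x / T); rewrite -/z intrD => h1 h2.
rewrite ler_pdivlMr// in h1; rewrite ltr_pdivrMr// mulrDl mul1r in h2.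
by apply/andP; split; lra.
Qed.

(** [al] is half a polar angle of the vector [(x, y)], the two factors being [cos (2 al)] and
    [sin (2 al)]. *)
Lemma angle_doubling (R : realType) (x y : R) :
  exists2 al : R, 0 <= al < 2 * pi &
    Num.sqrt (x ^+ 2 + y ^+ 2) * (cos al ^+ 2 - sin al ^+ 2) = x /\
    Num.sqrt (x ^+ 2 + y ^+ 2) * (2 * (sin al * cos al)) = y.
Proof.
have pi0 := @pi_gt0 R.
have c2 (a : R) : cos a ^+ 2 - sin a ^+ 2 = cos (a + a) by rewrite cosD; ring.
have s2 (a : R) : 2 * (sin a * cos a) = sin (a + a) by rewrite sinD; ring.
set N := Num.sqrt _.
have N2 : N ^+ 2 = x ^+ 2 + y ^+ 2 by rewrite sqr_sqrtr// addr_ge0 ?sqr_ge0.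
have N0 : 0 <= N by exact: sqrtr_ge0.
have [N00|Nn0] := eqVneq N 0.
  exists 0; first by rewrite lexx mulr_gt0.
  rewrite N00 expr0n/= in N2.
  have /eqP := esym N2; rewrite paddr_eq0 ?sqr_ge0// !sqrf_eq0 => /andP[/eqP-> /eqP->].
  by rewrite N00 !mul0r.
have Np : 0 < N by rewrite lt_neqAle eq_sym Nn0.
pose t := x / N.
have xN : `|x| <= N.
  by rewrite -(ger0_norm N0) -ler_sqr ?nnegrE// !real_normK ?num_real// N2 lerDl sqr_ge0.
have t1 : -1 <= t <= 1.
  by rewrite -ler_norml normrM normfV (ger0_norm N0) ler_pdivrMr// mul1r.
have be0 := acos_ge0 t1; have be1 := acos_lepi t1.
have cb : cos (acos t) = t by rewrite acosK// in_itv.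
have sb : N * sin (acos t) = `|y|.
  rewrite sin_acos// -{1}(ger0_norm N0) -sqrtr_sqr -sqrtrM ?sqr_ge0//.
  rewrite -sqrtr_sqr; congr Num.sqrt; rewrite mulrBr mulr1 {1}N2 /t expr_div_n.
  by rewrite mulrCA divff ?expf_neq0// mulr1; ring.
have [y0|y0] := leP 0 y.
  exists (acos t / 2); first by apply/andP; split; lra.
  rewrite c2 s2 -splitr cb sb ger0_norm//; split => //.
  by rewrite /t mulrCA divff// mulr1.
(* Below the horizontal axis the doubled angle is [2 * pi - acos t]: same cosine, opposite sine. *)
exists (pi - acos t / 2); first by apply/andP; split; lra.
rewrite c2 s2.
have -> : pi - acos t / 2 + (pi - acos t / 2) = - acos t + 2 * pi by field.
rewrite periodic2pi_cos periodic2pi_sin cosN sinN cb mulrN sb ltr0_norm// opprK; split => //.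
by rewrite /t mulrCA divff// mulr1.
Qed.

(** Principal axes: the eigenvalues are [M + N] and [M - N], with product [c ^+ 4], so dividing them
    by [c ^+ 2] gives inverse numbers [la ^+ 2] and [la ^- 2]. The axis is at half the polar angle
    of [((p - q) / 2, r)]. *)
Lemma quadratic_normal_form (R : realType) (p r q c : R) : 0 < p -> 0 < q -> 0 < c ->
  p * q - r ^+ 2 = c ^+ 4 ->
  exists la al : R, [/\ 0 < la, 0 <= al < 2 * pi & forall x,
    quadratic p r q x = c ^+ 2 * (la ^+ 2 * cos (x - al) ^+ 2 + la ^- 2 * sin (x - al) ^+ 2)].
Proof.
move=> p0 q0 c0 det.
have [al alb [E1 E2]] := angle_doubling ((p - q) / 2) r.
set N := Num.sqrt _ in E1 E2; pose M := (p + q) / 2.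
have N0 : 0 <= N by exact: sqrtr_ge0.
have MN : (M + N) * (M - N) = c ^+ 4.
  have N2 : N ^+ 2 = ((p - q) / 2) ^+ 2 + r ^+ 2 by rewrite sqr_sqrtr// addr_ge0 ?sqr_ge0.
  have -> : (M + N) * (M - N) = M ^+ 2 - N ^+ 2 by ring.
  by rewrite -det N2 /M; field.
have MN0 : 0 < M + N by rewrite /M; lra.
pose la := Num.sqrt ((M + N) / c ^+ 2).
have la2 : la ^+ 2 = (M + N) / c ^+ 2 by rewrite sqr_sqrtr// divr_ge0 ?ltW ?exprn_gt0.
exists la, al; split => //; first by rewrite sqrtr_gt0 divr_gt0 ?exprn_gt0.
move=> x; rewrite la2.
have -> : ((M + N) / c ^+ 2)^-1 = (M - N) / c ^+ 2.
  transitivity (c ^+ 4 / ((M + N) * c ^+ 2)); first by field; rewrite !gt_eqF.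
  by rewrite -MN; field; rewrite !gt_eqF.
rewrite cosB sinB /quadratic.
have -> : p = M + N * (cos al ^+ 2 - sin al ^+ 2) by rewrite E1 /M; field.
have -> : q = M - N * (cos al ^+ 2 - sin al ^+ 2) by rewrite E1 /M; field.
rewrite -{1}E2.
apply/eqP; rewrite -subr_eq0; apply/eqP.
transitivity (M * (cos x ^+ 2 + sin x ^+ 2) * (1 - (cos al ^+ 2 + sin al ^+ 2))).
  by field; rewrite gt_eqF.
by rewrite !cos2Dsin2 subrr mulr0.
Qed.

(** The forms on the two half circles share [b] and [k] and differ only through the constants [C1]
    and [C2]. Both have determinant [k ^- 2], and orthogonality to [cos] forces [C1 = C2]. *)
Lemma extremal_arcs_ellipse (R : realType) (b k : R) (u xi1 xi2 : R -> R) :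
  0 < b -> 0 < k -> continuous u -> (forall x, 0 < u x) -> periodic u (2 * pi) ->
  integ 0 (2 * pi) (fun x => cos x * u x ^- 3) = 0 ->
  extremal_arc b k u xi1 -> extremal_arc b k (fun x => u (x + pi)) xi2 ->
  exists la c al : R, [/\ 0 < la, 0 < c, 0 <= al < 2 * pi & forall x,
    u x = c * Num.sqrt (la ^+ 2 * cos (x - al) ^+ 2 + la ^- 2 * sin (x - al) ^+ 2)].
Proof.
move=> b0 k0 cu u0 uper ocos arc1 arc2; have pi0 := @pi_gt0 R.
have un0 x : u x != 0 by rewrite gt_eqF.
pose u2 x := u (x + pi).
have u20 x : 0 < u2 x by exact: u0.
have cu2 : continuous u2 by exact: continuous_shift.
have [C1 Q1] := extremal_arc_quadratic b0 k0 u0 arc1.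
have [C2 Q2] := extremal_arc_quadratic b0 k0 u20 arc2.
pose p := b ^+ 2 / k ^+ 4; pose q C := k ^+ 2 / b ^+ 2 * (1 + C ^+ 2).
have kV : k ^- 2 != 0 by rewrite invr_neq0// expf_neq0// gt_eqF.
have det C : p * q C - (C / k) ^+ 2 = k ^- 2.
  by rewrite /p /q; field; rewrite !gt_eqF.
have I1 := integ_cos_quadratic kV (det C1) cu u0 Q1.
have I2 := integ_cos_quadratic kV (det C2) cu2 u20 Q2.
have cc3 (A : set R) : {within A, continuous (fun x => cos x * u x ^- 3)}.
  apply: ctsM; first exact: cts_cos.
  apply: (ctsV (f := fun x => u x ^+ 3)) => [x|]; first by rewrite expf_neq0.
  by apply: ctsX; exact: continuous_subspaceT.
have cc32 (A : set R) : {within A, continuous (fun x => cos x * u2 x ^- 3)}.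
  apply: ctsM; first exact: cts_cos.
  apply: (ctsV (f := fun x => u2 x ^+ 3)) => [x|]; first by rewrite expf_neq0// gt_eqF.
  by apply: ctsX; exact: continuous_subspaceT.
have pipi : (pi + pi : R) = 2 * pi by ring.
have C12 : C1 = C2.
  have hpi : ((0 : R) <= pi) && (pi <= 2 * pi :> R) by apply/andP; split; lra.
  have shiftE : integ pi (2 * pi) (fun x => cos x * u x ^- 3) =
      - integ 0 pi (fun x => cos x * u2 x ^- 3).
    have := integ_shift (c := pi) (f := fun x => cos x * u x ^- 3) (ltW pi0) (cc3 _).
    rewrite add0r pipi => ->.
    rewrite -mulN1r -integZ; last by apply: continuous_intable; exact: cc32.
    by apply: eq_integ => x _; rewrite cosDpi /u2; ring.
  have := ocos; rewrite (integ_cat hpi); last by apply: continuous_intable; exact: cc3.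
  rewrite shiftE I1 I2 /u2 add0r pipi -(uper 0) add0r.
  rewrite [(u pi)^-1 + _]addrC; set w := (_^-1 + _) => E.
  have w0 : 0 < w by rewrite addr_gt0// invr_gt0.
  have {E} : w * k * (C1 - C2) = 0.
    by rewrite -oppr0 -{}E; field; rewrite gt_eqF.
  by move/eqP; rewrite !mulf_eq0 (gt_eqF w0) (gt_eqF k0) /= subr_eq0 => /eqP.
subst C2; set C := C1 in Q1 Q2; pose Q := quadratic p (C / k) (q C).
have cu2' : continuous (fun x => u x ^+ 2).
  by move=> x; under eq_fun do rewrite expr2; apply: cvgM; exact: cu.
have cQ : continuous Q by exact: quadratic_continuous.
have Qper : periodic Q (2 * pi).
  by move=> x; rewrite -pipi addrA /Q !quadratic_pi.
have uQ1 x : 0 < x < pi -> u x ^+ 2 = Q x by exact: Q1.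
have uQ2 x : pi < x < 2 * pi -> u x ^+ 2 = Q x.
  move=> /andP[h1 h2]; rewrite -(subrK pi x) /Q quadratic_pi; apply: Q2.
  by apply/andP; split; lra.
have uQ x : u x ^+ 2 = Q x.
  apply: (@periodic_eq _ (2 * pi) (fun x => u x ^+ 2) Q) => //; first by rewrite mulr_gt0.
    by move=> y; rewrite uper.
  (* The junction points 0 and [pi] are reached by continuity from the right. *)
  move=> y /andP[]; rewrite le_eqVlt => /predU1P[<- _|y0 y2].
    exact: (continuous_eq_left pi0 cu2' cQ uQ1).
  have [ypi|piy|->] := ltgtP y pi; [by apply: uQ1; rewrite y0|by apply: uQ2; rewrite piy|].
  by apply: (continuous_eq_left _ cu2' cQ uQ2); lra.
(* Chosen so that [c ^+ 4] is the determinant [k ^- 2] of the form. *)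
pose c := Num.sqrt k^-1.
have c0 : 0 < c by rewrite sqrtr_gt0 invr_gt0.
have c2 : c ^+ 2 = k^-1 by rewrite sqr_sqrtr// invr_ge0 ltW.
have c4 : c ^+ 4 = k ^- 2 by rewrite -[4%N]/(2 * 2)%N exprM c2 exprVn.
have p0 : 0 < p by rewrite divr_gt0 ?exprn_gt0.
have q0 : 0 < q C by rewrite mulr_gt0 ?divr_gt0 ?exprn_gt0// ltr_pwDl ?sqr_ge0.
have [la [al [la0 alb laE]]] := quadratic_normal_form p0 q0 c0 (etrans (det C) (esym c4)).
exists la, c, al; split => // x.
by rewrite -(gtr0_norm (u0 x)) -sqrtr_sqr uQ /Q laE sqrtrM ?sqr_ge0// sqrtr_sqr gtr0_norm.
Qed.

(** * From weak derivatives to absolute continuity *)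

(** Trigonometric polynomials centred at [a], encoded by two algebraic polynomials in the cosine.
    Replacing [sin ^+ 2] by [1 - cos ^+ 2] makes this shape stable under derivation. *)
Definition trig_poly (R : realType) (a : R) (p q : {poly R}) (x : R) : R :=
  p.[cos (x - a)] + sin (x - a) * q.[cos (x - a)].

Lemma trig_poly_derive (R : realType) (a : R) (p q : {poly R}) (x : R) :
  is_derive x 1 (trig_poly a p q)
    (trig_poly a ('X * q - (1%:P - 'X^2) * q^`()) (- p^`()) x).
Proof.
have dx := derB (der_id x) (der_cst a x).
have dc := der_comp dx (is_derive_cos (x - a)).
have ds := der_comp dx (is_derive_sin (x - a)).
have dp := der_comp dc (is_derive_poly p (cos (x - a))).
have dq := der_comp dc (is_derive_poly q (cos (x - a))).
apply: (is_derive_eq (derD dp (derM ds dq))).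
rewrite /trig_poly !(hornerD, hornerM, hornerN, hornerX, hornerC, hornerXn) 
  -(sin2cos2 (x - a)); ring.
Qed.

Lemma smooth_trig_poly (R : realType) (a : R) (p q : {poly R}) :
  smooth_circle (trig_poly a p q).
Proof.
split.
  by move=> x; rewrite /trig_poly addrAC periodic2pi_sin periodic2pi_cos.
have E p0 q0 : derive1 (trig_poly a p0 q0) =
    trig_poly a ('X * q0 - (1%:P - 'X^2) * q0^`()) (- p0^`()).
  by apply/funext => x; rewrite derive1E; have [_ ->] := trig_poly_derive a p0 q0 x.
move=> n; elim: n p q => [|n IH] p q x.
  by rewrite derive1n0; have [] := trig_poly_derive a p q x.
by rewrite derive1Sn E; exact: IH.
Qed.

Lemma bernoulli_ineq (R : realType) (e : R) n : 0 <= e -> 1 + n%:R * e <= (1 + e) ^+ n.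
Proof.
move=> e0; elim: n => [|n IH]; first by rewrite mul0r addr0 expr0.
rewrite exprSr; apply: (@le_trans _ _ ((1 + n%:R * e) * (1 + e))).
  have : 0 <= n%:R * e * e by rewrite !mulr_ge0.
  by rewrite -natr1; lra.
by rewrite ler_wpM2r// addr_ge0.
Qed.

Lemma integ_cst (R : realType) (a b c : R) : a <= b -> integ a b (fun=> c) = c * (b - a).
Proof.
move=> ab; have P : primitive a b (fun x => c * x) (fun=> c).
  apply: derivable_primitiveT => [x _|]; last exact: cts_cst.
  by apply: (is_derive_eq (derM (der_cst c x) (der_id x))); ring.
by rewrite -(primitiveE ab P) mulrBr.
Qed.

(* The kernels [(1 + cos (x - a) - cos d)^n] grow geometrically near [a] and
   stay bounded at distance at least [d] from [a]. *)
Lemma trig_orthogonal_le0 (R : realType) (V : R -> R) :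
  {within `[0, 2 * pi], continuous V} ->
  (forall a (p : {poly R}), integ 0 (2 * pi) (fun x => V x * p.[cos (x - a)]) = 0) ->
  forall x, 0 < x < 2 * pi -> V x <= 0.
Proof.
move=> cV orth a aI; have pi0 := @pi_gt0 R; have /andP[a0 a2] := aI.
have pi20 : 0 < 2 * pi :> R by rewrite mulr_gt0.
rewrite leNgt; apply/negP => Va.
have cVa : {for a, continuous V}.
  by apply: (within_continuous_continuous pi20 cV); rewrite in_itv.
have near1 : \forall x \near a, V a / 2 < V x.
  have lt : V a / 2 < V a by lra.
  exact: (cvgr_gt (V a) cVa _ lt).
have [e /= e0 He] := near1.
(* [d] keeps the neighbourhood of [a] inside (0, 2 pi) and where [V > V a / 2], and stays in the
   range where [cos] decreases. *)
have [d [d0 d1 d2 d3 d4]] : exists d, [/\ 0 < d, d <= e / 2, d <= a / 2,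
    d <= (2 * pi - a) / 2 & d <= pi / 2].
  exists (Num.min (e / 2) (Num.min (a / 2) (Num.min ((2 * pi - a) / 2) (pi / 2)))).
  rewrite !lt_min !divr_gt0 ?subr_gt0//; set d := Num.min _ _.
  by have := lexx d; rewrite {2}/d !le_min => /and4P[].
have near2 x : `|x - a| <= d -> V a / 2 <= V x.
  move=> xd; apply/ltW/He => /=; rewrite distrC; lra.
have cosd (y z : R) : 0 <= y -> y <= z -> z <= pi -> cos z <= cos y.
  move=> y0 yz zpi; rewrite le_eqVlt in yz; case/predU1P: yz => [->//|yz].
  by apply/ltW; rewrite ltr_cos// in_itv/=; apply/andP; split; lra.
have dd : d / 2 <= d by rewrite ler_pdivrMr// ler_peMr ?ler1n// ltW.
pose eta := cos (d / 2) - cos d.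
have eta0 : 0 < eta by rewrite subr_gt0 ltr_cos ?in_itv/=; [lra|apply/andP; split; lra..].
have eta1 : 0 <= 1 + eta by rewrite addr_ge0// ltW.
pose ka x : R := 1 + cos (x - a) - cos d.
have ka1 x : `|x - a| <= d -> 1 <= ka x.
  by move=> h; have := cosd _ _ (normr_ge0 (x - a)) h; rewrite cos_norm /ka; lra.
have ka2 x : `|x - a| <= d / 2 -> 1 + eta <= ka x.
  by move=> h; have := cosd _ _ (normr_ge0 (x - a)) h; rewrite cos_norm /ka /eta; lra.
have cosd1 : 0 <= cos d by apply: cos_ge0_pihalf; apply/andP; split; lra.
have ka3 x : 0 <= x <= 2 * pi -> d <= `|x - a| -> `|ka x| <= 1.
  move=> /andP[x0 x2] h; have cx : cos (x - a) <= cos d.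
    rewrite -[cos (x - a)]cos_norm.
    have [xpi|xpi] := leP `|x - a| pi; first exact: cosd (ltW d0) h xpi.
    (* The distance on the circle is now [2 * pi - |x - a|], still at least [d] since [d] is below
       both [a] and [2 * pi - a]. *)
    have h2 : `|x - a| <= 2 * pi - d by rewrite ler_norml; apply/andP; split; lra.
    by rewrite -cosN -periodic2pi_cos; apply: cosd; lra.
  have := cos_geN1 (x - a); have := cos_le1 d; rewrite ler_norml /ka.
  by move=> ? ?; apply/andP; split; lra.
have cka (A : set R) n : {within A, continuous (fun x => ka x ^+ n)}.
  apply: ctsX; apply: ctsB; last exact: cts_cst; apply: ctsD; first exact: cts_cst.
  by apply: continuous_subspaceT; apply: continuous_shift; exact: continuous_cos.
have cVk n : {within `[0, 2 * pi], continuous (fun x => V x * ka x ^+ n)} by exact: ctsM.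
have iV := continuous_intable cV; have iVn := intable_norm iV.
pose K := integ 0 (2 * pi) (fun x => `|V x|).
(* Near [a] both factors are nonnegative; elsewhere the kernel is at most 1 in absolute value. *)
have lb n x : 0 <= x <= 2 * pi -> - `|V x| <= V x * ka x ^+ n.
  move=> xI; have [xd|/ltW xd] := leP `|x - a| d.
    apply: (@le_trans _ _ 0); first by rewrite oppr_le0.
    have := near2 _ xd; have := ka1 _ xd => h1 h2.
    by rewrite mulr_ge0 ?exprn_ge0//; lra.
  rewrite -[X in _ <= X]opprK lerN2 -mulNr; apply: (le_trans (ler_norm _)).
  rewrite normrM normrN normrX ler_piMr// exprn_ile1//; exact: ka3.
have part n s t : 0 <= s -> s <= t -> t <= 2 * pi ->
    - K <= integ s t (fun x => V x * ka x ^+ n).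
  move=> s0 st t2; apply: (@le_trans _ _ (integ s t (fun x => (-1) * `|V x|))).
    rewrite integZ; last exact: intableS iVn.
    rewrite mulN1r lerN2 /K.
    have h1 : (0 <= s) && (s <= 2 * pi) by rewrite s0 (le_trans st).
    have h2 : (s <= t) && (t <= 2 * pi) by rewrite st.
    rewrite (integ_cat h1 iVn) (integ_cat h2); last exact: intableS iVn.
    have n1 : 0 <= integ 0 s (fun x => `|V x|) by apply: integ_ge0.
    have n2 : 0 <= integ t (2 * pi) (fun x => `|V x|) by apply: integ_ge0.
    lra.
  apply: le_integ.
  - by apply: intableZ; exact: intableS iVn.
  - by apply: (@intableS _ 0 (2 * pi)) => //; exact: continuous_intable.
  by move=> x /andP[sx xt]; rewrite mulN1r lb// (le_trans s0 sx)/= (le_trans xt).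
(* The total integral is zero and each outer part is at least [- K], so the part over
   [a - d / 2, a + d / 2] is at most [2 * K]. There Bernoulli's inequality gives a lower bound
   growing linearly in [n], which is impossible for large [n]. *)
have main n : V a / 2 * (1 + n%:R * eta) * d <= 2 * K.
  have I0 : integ 0 (2 * pi) (fun x => V x * ka x ^+ n) = 0.
    apply: etrans (orth a (('X + (1 - cos d)%:P) ^+ n)); apply: eq_integ => x _.
    by rewrite horner_exp hornerD hornerX hornerC /ka; congr (_ * _ ^+ _); ring.
  have icat s t : 0 <= s -> t <= 2 * pi -> intable s t (fun x => V x * ka x ^+ n).
    by move=> s0 t2; apply: (@intableS _ 0 (2 * pi)) => //; exact: continuous_intable.
  have h1 : (0 <= a - d / 2) && (a - d / 2 <= 2 * pi) by apply/andP; split; lra.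
  have h2 : (a - d / 2 <= a + d / 2) && (a + d / 2 <= 2 * pi) by apply/andP; split; lra.
  have [l0 l2] := andP h1; have [lr r2] := andP h2.
  move: I0; rewrite (integ_cat h1) ?(integ_cat h2); [|exact: icat..].
  have p1 : - K <= integ 0 (a - d / 2) (fun x => V x * ka x ^+ n) by apply: part.
  have p3 : - K <= integ (a + d / 2) (2 * pi) (fun x => V x * ka x ^+ n).
    by apply: part => //; lra.
  have p2 : V a / 2 * (1 + n%:R * eta) * d <=
      integ (a - d / 2) (a + d / 2) (fun x => V x * ka x ^+ n).
    apply: (@le_trans _ _ (integ (a - d / 2) (a + d / 2) (fun=> V a / 2 * (1 + n%:R * eta)))).
      by rewrite integ_cst// le_eqVlt; apply/orP; left; apply/eqP; field.
    apply: le_integ; [by apply: continuous_intable; exact: cts_cst|exact: icat|].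
    move=> x /andP[xl xr].
    have xd : `|x - a| <= d / 2 by rewrite ler_norml; apply/andP; split; lra.
    have k1 := ka2 _ xd.
    apply: ler_pM.
    - by rewrite divr_ge0// ltW.
    - by rewrite addr_ge0// mulr_ge0// ltW.
    - exact: near2 (le_trans xd dd).
    apply: (le_trans (bernoulli_ineq n (ltW eta0))).
    by apply: lerXn2r; rewrite ?nnegrE ?eta1 ?(le_trans eta1 k1).
  lra.
pose c := V a / 2 * eta * d.
have c0 : 0 < c by rewrite !mulr_gt0.
have [n nP] : exists n : nat, 2 * K / c < n%:R.
  exists (Num.bound (2 * K / c)); rewrite archi_boundP// divr_ge0 ?(ltW c0)// mulr_ge0//.
  exact: integ_ge0.
rewrite ltr_pdivrMr// in nP.
have := main n; rewrite leNgt => /negP; apply; apply: (lt_trans nP).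
have t0 : 0 < V a / 2 * d by rewrite !mulr_gt0.
rewrite -subr_gt0; rewrite (_ : _ - _ = V a / 2 * d)//; rewrite /c; ring.
Qed.

Lemma within_eq0_closed (R : realType) (a b : R) (V : R -> R) : a < b ->
  {within `[a, b], continuous V} -> (forall x, a < x < b -> V x = 0) ->
  forall x, a <= x <= b -> V x = 0.
Proof.
move=> ab cV V0; have [_ Va Vb] := (continuous_within_itvP V ab).1 cV.
have Ha : \forall x \near a^'+, V x = 0.
  near=> x; apply: V0; apply/andP; split.
    by near: x; exact: nbhs_right_gt.
  by near: x; exact: nbhs_right_lt.
have Hb : \forall x \near b^'-, V x = 0.
  near=> x; apply: V0; apply/andP; split.
    by near: x; exact: nbhs_left_gt.
  by near: x; exact: nbhs_left_lt.
move=> x /andP[]; rewrite le_eqVlt => /predU1P[<- _|ax].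
  apply/eqP; rewrite eq_le; apply/andP; split.
    by apply: (cvgr_to_le Va); apply: filterS Ha => y ->.
  by apply: (cvgr_to_ge Va); apply: filterS Ha => y ->.
rewrite le_eqVlt => /predU1P[->|xb]; last by apply: V0; rewrite ax.
apply/eqP; rewrite eq_le; apply/andP; split.
  by apply: (cvgr_to_le Vb); apply: filterS Hb => y ->.
by apply: (cvgr_to_ge Vb); apply: filterS Hb => y ->.
Unshelve. all: by end_near. Qed.

(** On a set of finite measure [|g| <= 1 + g ^+ 2] gives integrability. *)
Lemma L2_intable (R : realType) (g : R -> R) : L2_circle g ->
  intable 0 (2 * pi) g /\ intable 0 (2 * pi) (fun x => g x ^+ 2).
Proof.
move=> [mg ig2]; split => //.
have i1 : intable 0 (2 * pi) (fun x => 1 + g x ^+ 2).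
  by apply: intableD => //; apply: continuous_intable; exact: cts_cst.
apply: (@le_integrable _ _ R lebesgue_measure _ (measurable_itv _) _ _ _ _ i1).
  exact/measurable_realfun.measurable_EFinP.
move=> x _ /=.
rewrite lee_fin [X in _ <= X]ger0_norm ?addr_ge0 ?sqr_ge0//.
rewrite -(real_normK (num_real (g x))); have := sqr_ge0 (`|g x| - 1).
by have := sqr_ge0 (`|g x|); nra.
Qed.

Lemma integ_eq0 (R : realType) (a b : R) (f : R -> R) : a <= b ->
  (forall x, a <= x <= b -> f x = 0) -> integ a b f = 0.
Proof. by move=> ab f0; rewrite (eq_integ f0) integ_cst// mul0r. Qed.

(* Testing the weak derivative against trigonometric polynomials shows that
   [u - integral of g] is orthogonal to all of them, up to its mean value. *)
Lemma weak_derivative_primitive (R : realType) (u g : R -> R) :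
  continuous u -> weak_derivative u g -> primitive 0 (2 * pi) u g.
Proof.
move=> cu [L2g wd]; have [ig _] := L2_intable L2g; have pi0 := @pi_gt0 R.
have pi20 : 0 < 2 * pi :> R by rewrite mulr_gt0.
pose G x := integ 0 x g.
have PG : primitive 0 (2 * pi) G g by split => // x _; rewrite /G integxx add0r.
have cG := primitive_continuous (ltW pi20) PG.
have wdT (a : R) (p q : {poly R}) :
    integ 0 (2 * pi) (fun x => u x * trig_poly a ('X * q - (1%:P - 'X^2) * q^`()) (- p^`()) x) =
    - integ 0 (2 * pi) (fun x => g x * trig_poly a p q x).
  have := wd _ (smooth_trig_poly a p q); rewrite -/(integ _ _ _) => <-.
  apply: eq_integ => x _; rewrite derive1E.
  by have [_ ->] := trig_poly_derive a p q x.
have cT (a : R) (p q : {poly R}) (A : set R) : {within A, continuous (trig_poly a p q)}.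
  apply: continuous_subspaceT => x; apply: differentiable_continuous.
  by apply/derivable1_diffP; have [] := trig_poly_derive a p q x.
have PT (a : R) (p q : {poly R}) : primitive 0 (2 * pi) (trig_poly a p q)
    (trig_poly a ('X * q - (1%:P - 'X^2) * q^`()) (- p^`())).
  by apply: derivable_primitiveT => [x _|]; [exact: trig_poly_derive|exact: cT].
have perT (a : R) (p q : {poly R}) : trig_poly a p q (2 * pi) = trig_poly a p q 0.
  by have [h _] := smooth_trig_poly a p q; rewrite -(h 0) add0r.
have Tc (a k x : R) : trig_poly a k%:P 0 x = k by rewrite /trig_poly hornerC horner0 mulr0 addr0.
(* Testing against the constant 1 shows that [g] has mean zero, which removes the boundary term when
   [G] is integrated by parts. *)
have G2pi : G (2 * pi) = 0.
  have := wdT 0 1%:P 0; rewrite derivC mulr0 deriv0 mulr0 subr0 oppr0.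
  rewrite (_ : integ _ _ _ = 0); last first.
    apply: integ_eq0 => [|x _]; first exact: ltW.
    by rewrite /trig_poly horner0 !mulr0 addr0 mulr0.
  move=> /esym/eqP; rewrite oppr_eq0 => /eqP <-; apply: eq_integ => x _.
  by rewrite Tc mulr1.
have G0 : G 0 = 0 by rewrite /G integxx.
have cuw : {within `[0, 2 * pi], continuous u} by exact: continuous_subspaceT.
pose v x := u x - G x.
have cv : {within `[0, 2 * pi], continuous v} by exact: ctsB.
pose c := integ 0 (2 * pi) v / (2 * pi).
pose V x := v x - c.
have cV : {within `[0, 2 * pi], continuous V} by apply: ctsB => //; exact: cts_cst.
have IV : integ 0 (2 * pi) V = 0.
  rewrite /V integD; [|exact: continuous_intable|by apply: continuous_intable; exact: cts_cst].
  by rewrite integ_cst ?ltW// subr0 /c mulNr divfK ?subrr// gt_eqF.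
(* The weak derivative moves the derivative from the test function to [u], and integration by parts
   does the same for [G]. Both give the integral of [- g * t], which cancels; the constant [c] drops
   out as [t] is periodic. *)
have Vd (a : R) (p q : {poly R}) : integ 0 (2 * pi) (fun x => V x * trig_poly a ('X * q - (1%:P - 'X^2) * q^`()) (- p^`()) x) = 0.
  set t := trig_poly a p q; set t' := trig_poly a _ _.
  have ct' (A : set R) : {within A, continuous t'} by exact: cT.
  have cst : {within `[0, 2 * pi], continuous t} by exact: cT.
  have e1 := primitiveE (ltW pi20) (primitiveM (ltW pi20) PG (PT a p q)).
  have e2 := primitiveE (ltW pi20) (PT a p q).
  rewrite perT subrr in e2; rewrite G2pi G0 !mul0r subrr -/t -/t' in e1.
  rewrite -/t' in e2; have e3 := wdT a p q; rewrite -/t -/t' in e3.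
  have iu : intable 0 (2 * pi) (fun x => u x * t' x) by apply: continuous_intable; exact: ctsM.
  have iG : intable 0 (2 * pi) (fun x => t' x * G x) by apply: continuous_intable; exact: ctsM.
  have igt : intable 0 (2 * pi) (fun x => g x * t x) by exact: intableM.
  have it' : intable 0 (2 * pi) t' by exact: continuous_intable.
  rewrite integD// in e1.
  rewrite (_ : integ _ _ _ = integ 0 (2 * pi) (fun x => u x * t' x + (-1) * (t' x * G x) + (- c) * t' x)).
    rewrite integD; [|by apply: intableD => //; exact: intableZ|exact: intableZ].
    rewrite integD//; last exact: intableZ.
    rewrite !integZ// -e2 mulr0 addr0 e3; lra.
  by apply: eq_integ => x _; rewrite /V /v; ring.
have ccos (a : R) : {within `[0, 2 * pi], continuous (fun x => cos (x - a))}.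
  by apply: continuous_subspaceT; apply: continuous_shift; exact: continuous_cos.
have cpcos (a : R) (p : {poly R}) : {within `[0, 2 * pi], continuous (fun x => p.[cos (x - a)])}.
  have := cT a p 0 `[0, 2 * pi]%classic; rewrite (_ : trig_poly _ _ _ = (fun x => p.[cos (x - a)]))//.
  by apply/funext => x; rewrite /trig_poly horner0 mulr0 addr0.
have Vcos (a : R) n : integ 0 (2 * pi) (fun x => V x * cos (x - a) ^+ n) = 0.
  have cVn m : {within `[0, 2 * pi], continuous (fun x => V x * cos (x - a) ^+ m)}.
    by apply: ctsM => //; exact: ctsX.
  have iVn m := continuous_intable (cVn m).
  suff : integ 0 (2 * pi) (fun x => V x * cos (x - a) ^+ n) = 0 /\
         integ 0 (2 * pi) (fun x => V x * cos (x - a) ^+ n.+1) = 0 by case.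
  elim: n => [|n [IH1 IH2]]; split => //.
  - by apply: etrans IV; apply: eq_integ => x _; rewrite expr0 mulr1.
  - apply: etrans (Vd a 0 1%:P); apply: eq_integ => x _.
    by rewrite /trig_poly derivC deriv0 oppr0 mulr0 subr0 mulr1 hornerX horner0 mulr0 addr0 expr1.
  (* The derivative of [sin * cos ^+ n.+1] is [n.+2 * cos ^+ n.+2 - n.+1 * cos ^+ n], a recurrence
     of step two; hence the induction carries two consecutive powers. *)
  - have := Vd a 0 'X^(n.+1).
    rewrite (_ : integ _ _ _ = integ 0 (2 * pi) (fun x => n.+2%:R * (V x * cos (x - a) ^+ n.+2) + (- n.+1%:R) * (V x * cos (x - a) ^+ n))).
      rewrite integD ?integZ//; [|exact: intableZ..].
      rewrite IH1 mulr0 addr0 => /eqP; rewrite mulf_eq0 pnatr_eq0 /= => /eqP ->//.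
    apply: eq_integ => x _; rewrite /trig_poly deriv0 oppr0 horner0 mulr0 addr0 derivXn.
    rewrite !(hornerD, hornerM, hornerN, hornerX, hornerC, hornerXn, hornerMn) /=.
    by rewrite -[X in _ * X ^+ n.+2]/(cos (x - a)) !exprS -!natr1 -mulr_natr -natr1; ring.
have orth (a : R) (p : {poly R}) : integ 0 (2 * pi) (fun x => V x * p.[cos (x - a)]) = 0.
  have icont (q : {poly R}) m : intable 0 (2 * pi) (fun x => V x * cos (x - a) ^+ m * q.[cos (x - a)]).
    by apply: continuous_intable; apply: ctsM => //; apply: ctsM => //; apply: ctsX.
  suff H n : integ 0 (2 * pi) (fun x => V x * cos (x - a) ^+ n * p.[cos (x - a)]) = 0.
    by apply: etrans (H 0%N); apply: eq_integ => x _; rewrite expr0 mulr1.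
  elim/poly_ind: p n => [|p k IH] n.
    apply: integ_eq0 => [|x _]; first exact: ltW.
    by rewrite horner0 mulr0.
  rewrite (_ : integ _ _ _ = integ 0 (2 * pi) (fun x => V x * cos (x - a) ^+ n.+1 * p.[cos (x - a)] + k * (V x * cos (x - a) ^+ n))).
    rewrite integD ?integZ ?IH ?Vcos ?mulr0 ?addr0//; [|apply: intableZ]; by apply: continuous_intable; apply: ctsM => //; exact: ctsX.
  apply: eq_integ => x _; rewrite hornerMXaddC exprSr; ring.
have le1 := trig_orthogonal_le0 cV orth.
have le2 := @trig_orthogonal_le0 _ (fun x => - V x) _ _.
have V0 x : 0 < x < 2 * pi -> V x = 0.
  move=> xI; apply/eqP; rewrite eq_le le1//= -oppr_le0; apply: le2 => //; first exact: ctsN.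
  move=> a p; transitivity (-1 * integ 0 (2 * pi) (fun x => V x * p.[cos (x - a)])).
    rewrite -integZ; first by apply: eq_integ => y _; ring.
    apply: continuous_intable; exact: ctsM.
  by rewrite orth mulr0.
have {}V0 := within_eq0_closed pi20 cV V0.
split => // x xI.
have e1 := V0 _ xI; have e2 := V0 0 ltac:(by rewrite lexx ltW).
by move: e1 e2; rewrite /V /v G0 /G; lra.
Qed.

(** * Ellipses attain equality *)

(** Lebesgue differentiation: [f], extended by zero, is almost everywhere the derivative of its
    indefinite integral, which is identically zero. *)
Lemma integ_eq0_ae (R : realType) (a b : R) (f : R -> R) :
  intable a b f -> (forall x, a <= x <= b -> integ a x f = 0) ->
  {ae lebesgue_measure, forall x, `[a, b]%classic x -> f x = 0}.
Proof.
move=> intf f0; pose f1 := f \_ `[a, b].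
have mab : measurable (`[a, b] : set R) by exact: measurable_itv.
have loc : locally_integrable [set: R] f1 by exact: integrable_locally.
(* The base point [a - 1] lies strictly below every point of [a, b], so [FTC1] applies at each of
   them. *)
have int1 (y : R) : lebesgue_measure.-integrable [set` Interval (BLeft (a - 1)) (BRight y)] (EFin \o f1).
  have h : lebesgue_measure.-integrable setT (EFin \o f1).
    have := (@integrable_mkcond _ _ R lebesgue_measure _ (EFin \o f) mab).1 intf.
    by rewrite restrict_EFin.
  exact: integrableS h.
have := FTC1 int1 loc.
apply: filterS; first exact: (ae_filter_ringOfSetsType lebesgue_measure).
move=> x H /=; rewrite in_itv/= => /andP[ax xb].
have F0 y : \int[lebesgue_measure]_(t in [set` Interval (BLeft (a - 1)) (BRight y)]) f1 t = 0.
  rewrite -Rintegral_mkcondr.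
  have [ya|ay] := ltP y a.
    rewrite (_ : _ `&` _ = set0) ?Rintegral_set0//.
    apply/seteqP; split => // z /=; rewrite !in_itv/= => -[/andP[_ zy] /andP[az _]]; lra.
  have [ba|ab] := ltP b a.
    rewrite (_ : _ `&` _ = set0) ?Rintegral_set0//.
    apply/seteqP; split => // z /=; rewrite !in_itv/= => -[_ /andP[az zb]]; lra.
  rewrite (_ : _ `&` _ = `[a, Num.min y b]%classic).
    by apply: f0; rewrite le_min ay ab/= ge_min lexx orbT.
  apply/seteqP; split => z /=; rewrite !in_itv/= le_min.
    by move=> [/andP[h1 h2] /andP[-> ->]]; rewrite h2.
  move=> /and3P[az zy zb]; rewrite az zy zb; split => //; rewrite andbT; lra.
have [|_] := H _; first by rewrite lte_fin; lra.
 rewrite (_ : (fun x0 => _) = cst 0); last by apply/funext => y; exact: F0.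
by rewrite derive1_cst /f1 patchE mem_set /= ?in_itv/= ?ax ?xb// => <-.
Qed.

(** Two derivatives of one absolutely continuous function agree almost everywhere. This replaces an
    arbitrary weak derivative by the classical one for ellipses. *)
Lemma primitive_unique_sqr (R : realType) (a b : R) (F f g : R -> R) :
  primitive a b F f -> primitive a b F g ->
  integ a b (fun x => f x ^+ 2) = integ a b (fun x => g x ^+ 2).
Proof.
move=> [intf FE] [intg GE].
have ing := intableZ (-1) intg.
have /integ_eq0_ae : forall x, a <= x <= b -> integ a x (fun y => f y + (-1) * g y) = 0.
  move=> x xab; have /andP[ax xb] := xab.
  rewrite integD ?integZ; [|exact: intableS intg|exact: intableS intf|exact: intableS ing].
  by have := FE _ xab; rewrite (GE _ xab); lra.
move=> /(_ (intableD intf ing)) ae0.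
rewrite /integ /Rintegral; congr fine.
have /integrableP[/measurable_realfun.measurable_EFinP mf _] := intf.
have /integrableP[/measurable_realfun.measurable_EFinP mg _] := intg.
apply: ae_eq_integral; first exact: measurable_itv.
- by apply/measurable_realfun.measurable_EFinP; exact: measurable_realfun.measurable_funX.
- by apply/measurable_realfun.measurable_EFinP; exact: measurable_realfun.measurable_funX.
apply: filterS ae0; first exact: (ae_filter_ringOfSetsType lebesgue_measure).
move=> x H xab; congr (_ ^+ 2)%:E; have := H xab; lra.
Qed.

(* [y + atan ((m - 1) sin cos / (cos^2 + m sin^2))] is the continuous branch of
   [atan (m tan y)]. *)
Lemma integ_inv_quadratic (R : realType) (la al : R) : 0 < la ->
  integ 0 (2 * pi) (fun x => (quadratic (la ^+ 2) 0 (la ^- 2) (x - al))^-1) = 2 * pi.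
Proof.
move=> la0; have pi0 := @pi_gt0 R; have pi20 : 0 <= 2 * pi :> R by rewrite mulr_ge0 ?ltW.
pose m := la ^- 2; have m0 : 0 < m by rewrite invr_gt0 exprn_gt0.
pose W x := cos x ^+ 2 + m * sin x ^+ 2; pose N x := (m - 1) * (sin x * cos x).
have pos (a b x : R) : 0 < a -> 0 < b -> 0 < a * cos x ^+ 2 + b * sin x ^+ 2.
  move=> a0 b0; have := cos2Dsin2 x; have := sqr_ge0 (cos x); have := sqr_ge0 (sin x).
  by move=> h1 h2 h3; have [h|h] := eqVneq (sin x) 0; [rewrite h expr0n /= in h3 *; nra|
    have : 0 < sin x ^+ 2 by [rewrite exprn_even_gt0]; nra].
have W0 x : 0 < W x by have := pos 1 m x ltr01 m0; rewrite mul1r.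
pose F x := x + atan (N x / W x).
have Q0 x : 0 < quadratic (la ^+ 2) 0 (la ^- 2) x.
  by rewrite /quadratic mulr0 mul0r addr0; apply: pos; rewrite ?exprn_gt0.
have dF (x : R) : is_derive x 1 F (quadratic (la ^+ 2) 0 (la ^- 2) x)^-1.
  have dc := is_derive_cos x; have ds := is_derive_sin x.
  have dW := derD (derX 2 dc) (derM (der_cst m x) (derX 2 ds)).
  have dN := derM (der_cst (m - 1) x) (derM ds dc).
  apply: (is_derive_eq (derD (der_id x) (der_comp (derM dN (derV dW (lt0r_neq0 (W0 x)))) (is_derive1_atan _)))).
  have la2 : la ^+ 2 = m^-1 by rewrite invrK.
  have Z0 := pos 1 (m ^+ 2) x ltr01 (exprn_gt0 2 m0); rewrite mul1r in Z0.
  have NW : N x ^+ 2 + W x ^+ 2 = cos x ^+ 2 + m ^+ 2 * sin x ^+ 2.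
    transitivity ((cos x ^+ 2 + m ^+ 2 * sin x ^+ 2) * (cos x ^+ 2 + sin x ^+ 2)).
      by rewrite /N /W; ring.
    by rewrite cos2Dsin2 mulr1.
  have NW0 : N x ^+ 2 + W x ^+ 2 != 0 by rewrite NW gt_eqF.
  have -> : (quadratic (la ^+ 2) 0 (la ^- 2) x)^-1 = m / (N x ^+ 2 + W x ^+ 2).
    rewrite NW -invf_div; congr (_^-1).
    by rewrite /quadratic la2 -/m; field; rewrite gt_eqF.
  have W0' := lt0r_neq0 (W0 x).
  rewrite -/(W x) -/(N x) /= !expr1.
  transitivity ((N x ^+ 2 + W x ^+ 2 + ((m - 1) * (cos x ^+ 2 - sin x ^+ 2) * W x - N x * (2 * (m - 1) * (sin x * cos x)))) / (N x ^+ 2 + W x ^+ 2)).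
    by field; rewrite NW0 W0'.
  congr (_ / _); rewrite NW /N /W.
  transitivity (cos x ^+ 2 + m ^+ 2 * sin x ^+ 2 +
      (m - 1) * (cos x ^+ 2 - m * sin x ^+ 2) * (cos x ^+ 2 + sin x ^+ 2)); first ring.
  rewrite cos2Dsin2; transitivity (m * (cos x ^+ 2 + sin x ^+ 2)); first ring.
  by rewrite cos2Dsin2 mulr1.
have dFa (x : R) : is_derive x 1 (fun y => F (y - al)) (quadratic (la ^+ 2) 0 (la ^- 2) (x - al))^-1.
  apply: (is_derive_eq (der_comp (derB (der_id x) (der_cst al x)) (dF (x - al)))).
  by rewrite subr0 mulr1.
have P : primitive 0 (2 * pi) (fun y => F (y - al)) (fun x => (quadratic (la ^+ 2) 0 (la ^- 2) (x - al))^-1).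
  apply: derivable_primitiveT.
  apply: (ctsV (f := fun x => quadratic (la ^+ 2) 0 (la ^- 2) (x - al))) => [x|]; first by rewrite gt_eqF.
  by apply: continuous_subspaceT; apply: continuous_shift; exact: quadratic_continuous.
(* The [atan] term is periodic, so only the identity term contributes to the increment. *)
rewrite -(primitiveE pi20 P) /F /N /W.
by rewrite [2 * pi - al]addrC periodic2pi_sin periodic2pi_cos sub0r; ring.
Qed.

(** These functions solve [u'' + u = c ^+ 4 * u ^- 3]. Multiplying by [u] and integrating by parts
    gives energy [- c ^+ 4 * Om], where [Om = 2 * pi / c ^+ 2] is the integral of [u ^- 2]. *)
Lemma ellipse_equality (R : realType) (la c al : R) (u g : R -> R) :
  0 < la -> 0 < c ->
  (forall x, u x = c * Num.sqrt (la ^+ 2 * cos (x - al) ^+ 2 + la ^- 2 * sin (x - al) ^+ 2)) ->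
  (forall x, 0 < u x) ->
  primitive 0 (2 * pi) u g ->
  (integ 0 (2 * pi) (fun x => g x ^+ 2) - integ 0 (2 * pi) (fun x => u x ^+ 2))
    * integ 0 (2 * pi) (fun x => u x ^- 2) = - (4 * pi ^+ 2).
Proof.
move=> la0 c0 uE u0 Pg; have pi0 := @pi_gt0 R.
have pi20 : 0 <= 2 * pi :> R by rewrite mulr_ge0 ?ltW.
pose p := c ^+ 2 * la ^+ 2; pose q := c ^+ 2 * la ^- 2.
have u2 x : u x ^+ 2 = quadratic p 0 q (x - al).
  rewrite uE exprMn sqr_sqrtr; last by apply: addr_ge0; apply: mulr_ge0; rewrite ?invr_ge0 sqr_ge0.
  by rewrite /quadratic /p /q; ring.
pose v x := u (x + al).
have v2 x : v x ^+ 2 = quadratic p 0 q x by rewrite /v u2 addrK.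
have dv (x : R) : is_derive x 1 v (((q - p) * (sin x * cos x) + 0 * (cos x ^+ 2 - sin x ^+ 2)) / v x).
  apply: derive_sqrt_quadratic => [y|]; first exact: u0.
  by near=> y; exact: v2.
pose D x := (q - p) * (sin (x - al) * cos (x - al)) / u x.
have du (x : R) : is_derive x 1 u (D x).
  have := der_comp (derB (der_id x) (der_cst al x)) (dv (x - al)).
  rewrite subr0 mulr1 mul0r addr0 /v subrK -/(D x).
  by rewrite (_ : (fun y => u (y - al + al)) = u)//; apply/funext => y; rewrite subrK.
have un0 x : u x != 0 by rewrite gt_eqF.
have cu (A : set R) : {within A, continuous u}.
  apply: continuous_subspaceT => x; apply: differentiable_continuous.
  by apply/derivable1_diffP; have [] := du x.
have csh (h : R -> R) (A : set R) : continuous h -> {within A, continuous (fun x => h (x - al))}.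
  by move=> ch; apply: continuous_subspaceT; exact: continuous_shift.
have cD (A : set R) : {within A, continuous D}.
  apply: ctsM; last exact: ctsV.
  apply: ctsM; first exact: cts_cst.
  by apply: ctsM; apply: csh; [exact: continuous_sin|exact: continuous_cos].
have PD : primitive 0 (2 * pi) u D by apply: derivable_primitiveT; exact: cD.
rewrite (primitive_unique_sqr Pg PD).
(* [S] is the product of [u] and its derivative [D]; it is periodic, so [S'] has integral zero, and
   [D ^+ 2 - u ^+ 2 = S' - c ^+ 4 * u ^- 2]. *)
pose S x := (q - p) * (sin (x - al) * cos (x - al)).
pose S' x := (q - p) * (cos (x - al) ^+ 2 - sin (x - al) ^+ 2).
have dS (x : R) : is_derive x 1 S (S' x).
  have dx := derB (der_id x) (der_cst al x).
  apply: (is_derive_eq (derM (der_cst (q - p) x) (derM (der_comp dx (is_derive_sin (x - al)))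
    (der_comp dx (is_derive_cos (x - al)))))).
  by rewrite /S'; ring.
have cS' : {within `[0, 2 * pi], continuous S'}.
  apply: ctsM; first exact: cts_cst.
  by apply: ctsB; apply: ctsX; apply: csh; [exact: continuous_cos|exact: continuous_sin].
have PS : primitive 0 (2 * pi) S S' by exact: derivable_primitiveT.
have S0 : integ 0 (2 * pi) S' = 0.
  rewrite -(primitiveE pi20 PS) /S [2 * pi - al]addrC periodic2pi_sin periodic2pi_cos sub0r.
  by rewrite subrr.
have pq : p * q = c ^+ 4 by rewrite /p /q; field; rewrite gt_eqF.
have cun : {within `[0, 2 * pi], continuous (fun x => u x ^- 2)}.
  by apply: (ctsV (f := fun x => u x ^+ 2)) => [x|]; [rewrite expf_neq0|exact: ctsX].
have iun := continuous_intable cun; have iS' := continuous_intable cS'.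
have iu2 : intable 0 (2 * pi) (fun x => u x ^+ 2) by apply: continuous_intable; exact: ctsX.
have iD2 : intable 0 (2 * pi) (fun x => D x ^+ 2) by apply: continuous_intable; exact: ctsX.
have -> : integ 0 (2 * pi) (fun x => D x ^+ 2) - integ 0 (2 * pi) (fun x => u x ^+ 2) =
    - c ^+ 4 * integ 0 (2 * pi) (fun x => u x ^- 2).
  rewrite -mulN1r -integZ// -integD//; last exact: intableZ.
  transitivity (integ 0 (2 * pi) (fun x => S' x + (- c ^+ 4) * u x ^- 2)).
    apply: eq_integ => x _.
    set s := sin (x - al); set co := cos (x - al).
    have cs : co ^+ 2 + s ^+ 2 = 1 by exact: cos2Dsin2.
    rewrite /S' /D -/s -/co -pq; set U := u x.
    have UQ : U ^+ 2 = p * co ^+ 2 + q * s ^+ 2 by rewrite /U u2 /quadratic -/s -/co; ring.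
    apply/eqP; rewrite -subr_eq0; apply/eqP.
    transitivity ((((q - p) * (s * co)) ^+ 2 - U ^+ 2 * U ^+ 2 -
      (q - p) * (co ^+ 2 - s ^+ 2) * U ^+ 2 + p * q) / U ^+ 2); first by field; rewrite un0.
    rewrite UQ [X in X / _](_ : _ = p * q * (1 - (co ^+ 2 + s ^+ 2) ^+ 2)); last ring.
    by rewrite cs expr1n subrr mulr0 mul0r.
  by rewrite (integD iS' (intableZ (- c ^+ 4) iun)) integZ// S0 add0r.
have -> : integ 0 (2 * pi) (fun x => u x ^- 2) = 2 * pi / c ^+ 2.
  rewrite [RHS]mulrC.
  transitivity (c ^- 2 * integ 0 (2 * pi) (fun x => (quadratic (la ^+ 2) 0 (la ^- 2) (x - al))^-1)); last by rewrite integ_inv_quadratic.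
  rewrite -integZ.
    apply: eq_integ => x _; rewrite u2 -invfM; congr (_^-1).
    by rewrite /quadratic /p /q; ring.
  have := intableZ (c ^+ 2) iun; apply: eq_integrable => [|x _]; first exact: measurable_itv.
  rewrite /= u2; congr (_%:E); rewrite (_ : quadratic p 0 q _ = c ^+ 2 * quadratic (la ^+ 2) 0 (la ^- 2) (x - al)).
    by rewrite invfM mulrA divff ?mul1r// expf_neq0// gt_eqF.
  by rewrite /quadratic /p /q; ring.
by field; rewrite gt_eqF.
Unshelve. all: by end_near. Qed.

(** * The sharp inequality on the circle and its extremals *)

Theorem theorem1 (R : realType) (u u_theta : R -> R)
  (u_H1 : H1_circle u) (u_thetaP : weak_derivative u u_theta)
  (u_gt0 : forall theta : R, 0 < u theta)
  (u_orth : forall gamma : R,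
     \circint_(theta) (cos (theta + gamma) / (u theta) ^+ 3) = 0) :
  - (4 * pi ^+ 2) <=
    \circint_(theta) ((u_theta theta) ^+ 2 - (u theta) ^+ 2) *
    \circint_(theta) ((u theta) ^- 2)
  /\
  (\circint_(theta) ((u_theta theta) ^+ 2 - (u theta) ^+ 2) *
   \circint_(theta) ((u theta) ^- 2) = - (4 * pi ^+ 2)
   <->
   exists lambda c alpha : R,
     [/\ 0 < lambda, 0 < c, 0 <= alpha < 2 * pi &
         forall theta : R,
           u theta = c * Num.sqrt (lambda ^+ 2 * (cos (theta - alpha)) ^+ 2
                                   + lambda ^- 2 * (sin (theta - alpha)) ^+ 2)]).
Proof.
have [uper cu _] := u_H1.
have [_ ig2] := L2_intable u_thetaP.1.
have Pu := weak_derivative_primitive cu u_thetaP.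
have iu2 : intable 0 (2 * pi) (fun x => u x ^+ 2).
  by apply: continuous_intable; apply: ctsX; exact: continuous_subspaceT.
have ocos : integ 0 (2 * pi) (fun x => cos x * u x ^- 3) = 0.
  by apply: etrans (u_orth 0); apply: eq_integ => x _; rewrite addr0.
have osin : integ 0 (2 * pi) (fun x => sin x * u x ^- 3) = 0.
  by apply: etrans (u_orth (- (pi / 2))); apply: eq_integ => x _; rewrite cosBpihalf.
have -> : \circint_(theta) ((u_theta theta) ^+ 2 - (u theta) ^+ 2) =
    integ 0 (2 * pi) (fun x => u_theta x ^+ 2) - integ 0 (2 * pi) (fun x => u x ^+ 2).
  rewrite -mulN1r -integZ// -integD//; last exact: intableZ.
  by apply: eq_integ => x _; rewrite mulN1r.
have -> : \circint_(theta) ((u theta) ^- 2) = integ 0 (2 * pi) (fun x => u x ^- 2) by [].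
have [ineq eqcase] := circle_ineq cu u_gt0 uper Pu ig2 ocos osin.
split => //; split.
  move=> /eqcase [b [k [xi1 [xi2 [b0 k0 arc1 arc2]]]]].
  exact: extremal_arcs_ellipse b0 k0 cu u_gt0 uper ocos arc1 arc2.
move=> [la [c [al [la0 c0 _ uE]]]].
exact: ellipse_equality la0 c0 uE u_gt0 Pu.
Qed.
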